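(* For nonnegative integers $N,M$ with $N+M$ even and positive, let $A(N,M)$ denote the number of rhombus tilings of the hexagon $H(N,M)$ with side lengths $N,M,N,N,M,N$ which contain the rhombus above and next to the center of the hexagon (the axis rhombus $\rho_l$ with $l=(N+M)/2$), and let $T(N,M)=\prod_{i=1}^{N}\prod_{j=1}^{M}\prod_{k=1}^{N}\frac{i+j+k-1}{i+j+k-2}$. Let $n$ be a nonnegative integer, with $n\ge1$ in (a), (d) and (f). Then: (a) $\displaystyle A(2n,2n)=\left(\frac13-\frac1{12}\frac{\binom{2n}{n}^3}{\binom{6n}{3n}}\right)T(2n,2n)$; (b) $\displaystyle A(2n+1,2n+1)=\left(\frac13+\frac13\frac{\binom{2n}{n}^3}{\binom{6n+2}{3n+1}}\right)T(2n+1,2n+1)$; (c) $\displaystyle A(2n,2n+2)=\left(\frac13-\frac{10n+2}{6n+3}\frac{\binom{2n}{n}^3}{\binom{6n+2}{3n+1}}\right)T(2n,2n+2)$; (d) $\displaystyle A(2n+1,2n-1)=\left(\frac13+\frac{10n+3}{24n}\frac{\binom{2n}{n}^3}{\binom{6n}{3n}}\right)T(2n+1,2n-1)$; (e) $\displaystyle A(2n+2,2n)=\left(\frac13+4\frac{\binom{2n}{n}^3}{\binom{6n+4}{3n+2}}\right)T(2n+2,2n)$; (f) $\displaystyle A(2n+3,2n-1)=\left(\frac13+\frac{2(6n^2+9n+2)}{(n+1)^2}\frac{\binom{2n}{n}^3}{\binom{6n+4}{3n+2}}\right)T(2n+3,2n-1)$.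
   Context: Hexagon: $H(N,M)$ is the hexagon with all angles $120^\circ$ and side lengths, in cyclic order, $N,M,N,N,M,N$, placed with vertices $(0,0)$, $(\pm\frac{\sqrt3}{2}N,\frac N2)$, $(\pm\frac{\sqrt3}{2}N,\frac N2+M)$, $(0,N+M)$ (the sides of length $M$ are vertical). If $M=0$ it degenerates to a large rhombus, if $N=0$ to a segment whose only tiling is the empty one. It is subdivided into unit equilateral triangles by the triangular lattice generated by $(0,1)$ and $(\frac{\sqrt3}2,\frac12)$. A rhombus is the union of two unit lattice triangles sharing an edge (side lengths 1, angles $60^\circ$ and $120^\circ$); a rhombus tiling of $H(N,M)$ is a covering of $H(N,M)$ by such rhombi without overlaps. Axis rhombi: for $0\le l\le N+M-1$, $\rho_l$ is the rhombus with vertices $(0,l)$, $(0,l+1)$, $(\pm\frac{\sqrt3}{2},l+\frac12)$; these are the rhombi symmetric about the vertical symmetry axis (of length $N+M$). The center of the hexagon is $(0,\frac{N+M}2)$. Empty products are $1$. *)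

(* Defs.v *)
(* MathComp *)
From HB Require Import structures.
From mathcomp Require Import all_boot all_order all_algebra.

Set Implicit Arguments.
Unset Strict Implicit.
Unset Printing Implicit Defensive.

Import Order.TTheory GRing.Theory Num.Theory.
Local Open Scope ring_scope.

(* The pair (a, b) stands for the lattice point
   a * (sqrt 3 / 2, 1 / 2) + b * (0, 1), i.e., for the point of Cartesian
   coordinates x = a * sqrt 3 / 2 and y = a / 2 + b. *)
Definition point := (int * int)%type.

(* In these coordinates the vertices of H(N, M) are (0, 0), (N, 0), (N, M),
   (0, N + M), (- N, N + M), (- N, N), and each of the six inequalities below
   is the half-plane bounded by one of its sides. *)
Definition in_hexagon (N M : nat) (p : point) : bool :=
  [&& - N%:Z <= p.1 <= N%:Z,
      0 <= p.2 <= (N + M)%:Z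
    & 0 <= p.1 + p.2 <= (N + M)%:Z].

(* The unit lattice triangles in the parallelogram - N <= a <= N,
   0 <= b <= N + M, which contains H(N, M). The lattice cell with vertices
   (a, b), (a + 1, b), (a + 1, b + 1), (a, b + 1), where a = i - N and b = j,
   is cut by its short diagonal from (a + 1, b) to (a, b + 1) into the triangle
   (i, j, true) with a vertical left edge and the triangle (i, j, false) with a
   vertical right edge. *)
Definition triangle (N M : nat) := ('I_(2 * N) * 'I_(N + M) * bool)%type.

Definition vertices (N M : nat) (t : triangle N M) : seq point :=
  let: (i, j, d) := t in
  let a := (i : nat)%:Z - N%:Z in
  let b := (j : nat)%:Z in
  if d then [:: (a, b); (a, b + 1); (a + 1, b)]
  else [:: (a + 1, b); (a + 1, b + 1); (a, b + 1)].

Definition hexagon (N M : nat) : {set triangle N M} :=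
  [set t | all (in_hexagon N M) (vertices t)].

Definition share_edge (N M : nat) (t u : triangle N M) : bool :=
  count (mem (vertices u)) (vertices t) == 2%N.

(* Unions of unit triangles are represented by the sets of these triangles. *)
Definition is_rhombus (N M : nat) (r : {set triangle N M}) : bool :=
  [exists t, exists u, share_edge t u && (r == [set t; u])].

Definition is_tiling (N M : nat) (P : {set {set triangle N M}}) : bool :=
  partition P (hexagon N M) && [forall r in P, is_rhombus r].

(* The listed points are (0, l), (0, l + 1), (sqrt 3 / 2, l + 1 / 2) and
   (- sqrt 3 / 2, l + 1 / 2) in Cartesian coordinates. *)
Definition axis_rhombus_vertices (l : nat) : seq point :=
  [:: (0, l%:Z); (0, l%:Z + 1); (1, l%:Z); (-1, l%:Z + 1)].

(* For N = 0 this is the empty set, which belongs to no tiling. *)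
Definition axis_rhombus (N M l : nat) : {set triangle N M} :=
  [set t | all (mem (axis_rhombus_vertices l)) (vertices t)].

Definition A (N M : nat) : nat :=
  #|[set P : {set {set triangle N M}} |
      is_tiling P && (axis_rhombus N M (N + M)./2 \in P)]|.

Definition T (N M : nat) : rat :=
  \prod_(1 <= i < N.+1) \prod_(1 <= j < M.+1) \prod_(1 <= k < N.+1)
    (((i + j + k)%:R - 1) / ((i + j + k)%:R - 2)).

(* Main.v *)
Require Import Defs.
From mathcomp Require Import all_boot all_order all_algebra.
From mathcomp Require Import perm zify ring lra.

Set Implicit Arguments.
Unset Strict Implicit.
Unset Printing Implicit Defensive.

Import Order.TTheory GRing.Theory Num.Theory.
Local Open Scope ring_scope.

(* The axis rhombi of a tiling sit at the heights in an N-subset X of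
   {0, ..., N + M - 1}. Cutting along the axis, each half of the tiling is a
   sequence of interlacing sets shrinking from X to the empty set, hence there
   are (prod_{i < j} (x_j - x_i) / (j - i))^2 tilings with axis set X: the set
   X is a discrete orthogonal polynomial ensemble with constant weight. So
   A(N, M) / T(N, M) is its density at the point (N + M) / 2, namely
   sum_{k < N} p_k(1/2)^2 / h_k, where the p_k are the monic discrete Chebyshev
   polynomials on N + M points centered at 0, and h_k are their square norms.
   The values p_k(1/2) factor completely, and the terms with k = 2j and
   k = 2j + 1 together have a WZ mate with respect to the number of points;
   this evaluates the sum along N = M by induction. *)

(** * The hexagon in coordinates *)

(** Only the density has to be evaluated in closed form: the constant relating it to A(N, M) is
    shown to be T(N, M) by induction on M, so the total number of tilings is never computed. On 4n +
    2 points, N = 2n, 2n + 1, 2n + 2, 2n + 3 are the cases (c), (b), (e), (f); on 4n points, N = 2n,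
    2n + 1 are (a), (d). Within each group, neighbours differ by a single term of the sum. The WZ
    relation adds two points at fixed even N. This gives a staircase along the diagonal: from (c) at
    n to (e) at n by two more terms, then to (a) at n + 1 and to (c) at n + 1 by two points each. It
    starts from the empty sum N = 0, where the closed form reads 1/3 - 1/3: the constant 1/3 is
    simply carried along, and everything else is a rational multiple of one cubic ratio of
    binomials. *)

Lemma mem_hexagon (N M : nat) (i : 'I_(2 * N)) (j : 'I_(N + M)) (d : bool) :
  ((i, j, d) \in hexagon N M) = (N <= i + j + ~~ d < 2 * N + M)%N.
Proof.
have := ltn_ord i; have := ltn_ord j; rewrite inE /in_hexagon.
by case: d => /=; lia.
Qed.

Lemma eq_shift (N i i' : nat) :
  ((i%:Z - N%:Z == i'%:Z - N%:Z) = (i == i')) *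
  ((i%:Z - N%:Z + 1 == i'%:Z - N%:Z) = (i' == i.+1)) *
  ((i%:Z - N%:Z == i'%:Z - N%:Z + 1) = (i == i'.+1)) *
  ((i%:Z - N%:Z + 1 == i'%:Z - N%:Z + 1) = (i == i')) *
  ((i%:Z + 1 == i'%:Z + 1) = (i == i')) *
  ((i%:Z + 1 == i'%:Z) = (i' == i.+1)) *
  ((i%:Z == i'%:Z + 1) = (i == i'.+1)) *
  ((i%:Z == i'%:Z) = (i == i')).
Proof. by do !split; lia. Qed.

(** Propositional form of the exclusion between the three equalities, so that the case analysis on
    six Booleans in [share_edgeE] can discard the impossible combinations. *)
Lemma eq_shift_excl (i i' : nat) :
  [|| [&& i == i', i' != i.+1 & i != i'.+1], [&& i != i', i' == i.+1 & i != i'.+1],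
      [&& i != i', i' != i.+1 & i == i'.+1] | [&& i != i', i' != i.+1 & i != i'.+1]].
Proof. lia. Qed.

(** With [(i1, j1)] the triangle of type [true], the disjuncts are its three neighbours: in the same
    cell, across its vertical edge, and across its lower edge. *)
Lemma share_edgeE (N M : nat) (i i' : 'I_(2 * N)) (j j' : 'I_(N + M)) d d' :
  share_edge (i, j, d) (i', j', d') =
  (d != d') && let: (i1, j1, i2, j2) := if d then (i, j, i', j') else (i', j', i, j) in
  [|| (i2 == i1 :> nat) && (j2 == j1 :> nat), (i1 == i2.+1 :> nat) && (j2 == j1 :> nat)
    | (i2 == i1 :> nat) && (j1 == j2.+1 :> nat)].
Proof.
rewrite /share_edge.
case: d; case: d'; rewrite /= !inE !xpair_eqE !eq_shift ?(eq_sym (i' : nat) i)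
  ?(eq_sym (j' : nat) j); move: (eq_shift_excl i i') (eq_shift_excl j j');
by move: (i == i' :> nat) (i == i'.+1 :> nat) (i' == i.+1 :> nat)
  (j == j' :> nat) (j == j'.+1 :> nat) (j' == j.+1 :> nat) => [] [] [] [] [] [].
Qed.

(** The indices are natural numbers so that shifted indices need no bound proofs. An index out of
    range gives the empty set, a case which [fits] excludes. *)
Definition cell (N M i j : nat) (d : bool) : {set triangle N M} :=
  [set t : triangle N M | [&& t.1.1 == i :> nat, t.1.2 == j :> nat & t.2 == d]].

(* The rhombi covering the triangle (i, j, false): [a = true] is the one across
   the vertical edge, [b = true] the one across the edge above, and
   [a = b = false] the one inside a cell. *)
Definition lozenge (N M i j : nat) (a b : bool) : {set triangle N M} :=
  cell N M i j false :|: cell N M (i + a) (j + b) true.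

(** The test of [mem_hexagon] on natural numbers, with [k = i + j] for type [true] and
    [k = i + j + 1] for type [false]: inside the parallelogram only the two sides along which the
    sum of the coordinates is constant cut anything off. *)
Definition in_range (N M i j k : nat) : bool :=
  [&& i < 2 * N, j < N + M & N <= k < 2 * N + M]%N.

Definition fits (N M i j : nat) (a b : bool) : bool :=
  [&& ~~ (a && b), in_range N M i j (i + j).+1
    & in_range N M (i + a) (j + b) (i + a + (j + b))].

Lemma cell1 (N M : nat) (i : 'I_(2 * N)) (j : 'I_(N + M)) (d : bool) :
  cell N M i j d = [set (i, j, d)].
Proof. by apply/setP=> -[[i' j'] d']; rewrite !inE /= !xpair_eqE -andbA. Qed.

Lemma lozenge_false (N M i j : nat) (a b : bool) (i' : 'I_(2 * N)) (j' : 'I_(N + M)) :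
  ((i', j', false) \in lozenge N M i j a b) = (i' == i :> nat) && (j' == j :> nat).
Proof. by rewrite !inE /= andbT !andbF orbF. Qed.

Lemma lozenge_true (N M i j : nat) (a b : bool) (i' : 'I_(2 * N)) (j' : 'I_(N + M)) :
  ((i', j', true) \in lozenge N M i j a b)
  = (i' == i + a :> nat)%N && (j' == j + b :> nat)%N.
Proof. by rewrite !inE /= !andbF andbT. Qed.

Lemma lozenge_inj (N M i j i' j' : nat) (a b a' b' : bool) :
  fits N M i j a b -> lozenge N M i j a b = lozenge N M i' j' a' b' ->
  [/\ i' = i, j' = j, a' = a & b' = b].
Proof.
case/and3P=> _ /and3P[lti ltj _] /and3P[ltia ltjb _] /setP eq_r.
have := eq_r (Ordinal lti, Ordinal ltj, false).
rewrite !lozenge_false /= !eqxx => /esym/andP[/eqP ei /eqP ej]; subst i' j'.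
have := eq_r (Ordinal ltia, Ordinal ltjb, true).
rewrite !lozenge_true /= !eqxx !eqn_add2l => /esym/andP[].
by move: a a' b b' {eq_r ltia ltjb} => [] [] [] [].
Qed.

Lemma lozenge_rhombus (N M i j : nat) (a b : bool) :
  fits N M i j a b ->
  is_rhombus (lozenge N M i j a b) /\ lozenge N M i j a b \subset hexagon N M.
Proof.
case/and3P=> nab /and3P[lti ltj r1] /and3P[ltia ltjb r2].
have -> : lozenge N M i j a b =
    [set (Ordinal lti, Ordinal ltj, false); (Ordinal ltia, Ordinal ltjb, true)].
  by rewrite -!cell1.
split; last first.
  apply/subsetP=> t /set2P[] ->; rewrite mem_hexagon /=; last by rewrite addn0.
  by rewrite addn1.
apply/existsP; exists (Ordinal lti, Ordinal ltj, false).
apply/existsP; exists (Ordinal ltia, Ordinal ltjb, true).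
rewrite eqxx andbT share_edgeE /=; move: nab.
by move: a b {ltia ltjb r2} => [] [] // _; rewrite ?addn0 ?addn1 !eqxx ?orbT.
Qed.

Lemma rhombus_lozenge (N M : nat) (r : {set triangle N M}) :
  is_rhombus r -> r \subset hexagon N M ->
  exists i j a b, fits N M i j a b /\ r = lozenge N M i j a b.
Proof.
case/existsP=> t /existsP[u /andP[tu /eqP ->{r}]] /subsetP sub.
have {sub} [ht hu] : t \in hexagon N M /\ u \in hexagon N M.
  by split; apply: sub; rewrite !inE eqxx ?orbT.
wlog dt : t u tu ht hu / t.2 = true.
  move=> IH; case dt: t.2; first exact: IH.
  rewrite setUC; apply: IH => //.
    move: tu; case: t dt {ht} => [[i j] d] /= ->; case: u {hu} => [[i' j'] d'].
    by rewrite !share_edgeE; case: d'.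
  by move: tu dt; case: t {ht} => [[i j] d]; case: u {hu} => [[i' j'] d'];
    rewrite share_edgeE /=; case: d; case: d'.
case: t u tu ht hu dt => [[i j] d] [[i' j'] d'] + + + /= dt; subst d.
rewrite share_edgeE !mem_hexagon; case: d' => //= nb hexT hexF.
have [a [b [nab ei ej]]] : exists a b : bool,
    [/\ ~~ (a && b), i = i' + a :> nat & j = j' + b :> nat]%N.
  case/or3P: nb => /andP[/eqP e1 /eqP e2].
  - by exists false, false; rewrite e1 e2 !addn0.
  - by exists true, false; rewrite e1 e2 addn0 addn1.
  - by exists false, true; rewrite e1 e2 addn0 addn1.
exists i', j', a, b; split.
  rewrite /fits nab /in_range -ei -ej !ltn_ord /=.
  by move: hexT hexF; rewrite addn0 addn1 => -> ->.
by rewrite /lozenge -ei -ej !cell1 setUC.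
Qed.

Lemma tilingP (N M : nat) (P : {set {set triangle N M}}) :
  reflect
    [/\ forall r, r \in P -> exists i j a b,
          fits N M i j a b /\ r = lozenge N M i j a b,
        forall t, t \in hexagon N M -> exists2 r, r \in P & t \in r
      & forall t r r', r \in P -> r' \in P -> t \in r -> t \in r' -> r = r']
    (is_tiling P).
Proof.
apply: (iffP andP) => [[/and3P[/eqP cov triv n0] /forall_inP rh] | [Pl Pc Pu]].
  split=> [r Pr | t | t r r' Pr Pr' tr tr'].
  - apply: rhombus_lozenge; first exact: rh.
    by rewrite -cov; apply: bigcup_sup.
  - by rewrite -cov => /bigcupP[r Pr tr]; exists r.
  - by rewrite -(def_pblock triv Pr tr) (def_pblock triv Pr' tr').
split; last first.
  apply/forall_inP=> r /Pl[i [j [a [b [fit ->]]]]].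
  by have [] := lozenge_rhombus fit.
apply/and3P; split.
- rewrite eqEsubset; apply/andP; split.
    apply/bigcupsP=> r /Pl[i [j [a [b [fit ->]]]]].
    by have [] := lozenge_rhombus fit.
  by apply/subsetP=> t /Pc[r Pr tr]; apply/bigcupP; exists r.
- apply/trivIsetP=> r r' Pr Pr' /eqP neq; rewrite -setI_eq0; apply/eqP.
  by apply/setP=> t; rewrite !inE; apply/negP=> /andP[/(Pu t _ _ Pr Pr') H /H].
- apply/negP=> /Pl[i [j [a [b [/and3P[_ /and3P[lti ltj _] _]]]]]] /setP.
  by move=> /(_ (Ordinal lti, Ordinal ltj, false)); rewrite lozenge_false inE /= !eqxx.
Qed.

(** * Tilings as sequences of interlacing sets *)

(** Interlacing is first expressed by counting functions, because scanning a column upwards changes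
    them by at most one per row. *)
Definition below (n : nat) (X : {set 'I_n}) (j : nat) : nat :=
  #|[set x in X | x < j]%N|.

Lemma below0 (n : nat) (X : {set 'I_n}) : below X 0 = 0%N.
Proof. by apply: eq_card0 => x; rewrite !inE andbF. Qed.

Lemma belowS (n : nat) (X : {set 'I_n}) (j : 'I_n) :
  below X j.+1 = (below X j + (j \in X))%N.
Proof.
rewrite /below (cardsD1 j) inE ltnSn andbT addnC; congr (_ + _)%N.
apply: eq_card => x; rewrite !inE ltnS ltn_neqAle -val_eqE.
by rewrite andbCA.
Qed.

Lemma below_size (n : nat) (X : {set 'I_n}) (j : nat) :
  (forall x, x \in X -> x < j)%N -> below X j = #|X|.
Proof.
move=> lt_j; apply: eq_card => x; rewrite inE.
by case: (boolP (x \in X)) => // /lt_j ->.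
Qed.

Lemma below_le (n : nat) (X : {set 'I_n}) (j : nat) : (below X j <= #|X|)%N.
Proof. by apply/subset_leq_card/subsetP=> x; rewrite inE => /andP[]. Qed.

(* The rhombi across the left edge of column [i] are at the heights in [Y],
   those across its right edge at the heights in [Z]. *)
Definition column (N M i : nat) (Y Z : {set 'I_(N + M)}) : bool :=
  [forall j : 'I_(N + M),
     (below Z j <= (i < N) + below Y j)%N &&
     ((i < N) + below Y j.+1 <= 1 + below Z j)%N] &&
  ((i < N) + #|Y| == #|Z| + (N <= i))%N.

(* The triangle (i, j, true) is paired with the one below it. Outside of the
   hexagon this always holds: extending the tiling by such pairs to the whole
   parallelogram makes all columns behave alike. *)
Definition stacked (N M i : nat) (Y Z : {set 'I_(N + M)}) (j : nat) : bool :=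
  ((i < N) + below Y j == 1 + below Z j)%N.

(** The sum says that the triangle (i, j, true) is covered exactly once: from below, inside its
    cell, or across its left edge. The middle summand is 1 when (i, j, false) is claimed neither
    from above nor from the right. The second part says that these two claims never coincide. *)
Lemma stacked_rel (N M i : nat) (Y Z : {set 'I_(N + M)}) (j : 'I_(N + M)) :
  column i Y Z ->
  (stacked i Y Z j + (~~ stacked i Y Z j.+1 && (j \notin Z)) + (j \in Y) = 1)%N /\
  ~~ ((j \in Z) && stacked i Y Z j.+1).
Proof.
case/andP=> /forallP col /eqP sz; rewrite /stacked.
have /andP[c1 c2] := col j; have lt := ltn_ord j.
have c3 : (below Z j.+1 <= (i < N) + below Y j.+1)%N.
  case: (ltnP j.+1 (N + M)) => h; first by have /andP[] := col (Ordinal h).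
  rewrite !below_size => [|x _|x _]; try exact: leq_trans (ltn_ord x) h.
  lia.
have := belowS Y j; have := belowS Z j; move: c1 c2 c3.
by case: (j \in Y); case: (j \in Z); case: (i < N)%N; lia.
Qed.

Lemma stacked0 (N M i : nat) (Y Z : {set 'I_(N + M)}) : stacked i Y Z 0 = (i < N)%N.
Proof. by rewrite /stacked !below0; case: (i < N)%N. Qed.

Lemma stacked_top (N M i : nat) (Y Z : {set 'I_(N + M)}) :
  column i Y Z -> stacked i Y Z (N + M) = (N <= i)%N.
Proof.
case/andP=> _ /eqP sz; rewrite /stacked !below_size //; lia.
Qed.

(** The guard matters at [i = 0], where [i.-1] would designate column 0 itself instead of a column
    further left. *)
Definition crossing (N M : nat) (P : {set {set triangle N M}}) (i : nat) :
  {set 'I_(N + M)} :=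
  [set j : 'I_(N + M) | (0 < i)%N && (lozenge N M i.-1 j true false \in P)].

(** Counterpart of [stacked] read off a tiling, declared true outside of the hexagon for the same
    uniformity. *)
Definition paired_below (N M : nat) (P : {set {set triangle N M}}) (i j : nat) :=
  ~~ (N <= i + j < 2 * N + M)%N
  || (0 < j)%N && (lozenge N M i j.-1 false true \in P).

Lemma tiling_fits (N M i j : nat) (a b : bool) (P : {set {set triangle N M}}) :
  is_tiling P -> lozenge N M i j a b \in P -> fits N M i j a b.
Proof.
case/tilingP=> Pl _ _ /Pl[i' [j' [a' [b' [fit /esym/(lozenge_inj fit)]]]]].
by case=> -> -> -> ->.
Qed.

Lemma tiling_false (N M i j : nat) (P : {set {set triangle N M}}) :
  is_tiling P -> in_range N M i j (i + j).+1 ->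
  exists a b : bool, fits N M i j a b /\
    forall a' b' : bool,
      (lozenge N M i j a' b' \in P) = (a' == a) && (b' == b).
Proof.
move=> tP /and3P[lti ltj rg]; have /tilingP[Pl Pc Pu] := tP.
have [|r Pr] := Pc (Ordinal lti, Ordinal ltj, false).
  by rewrite mem_hexagon addn1.
have [i' [j' [a [b [fit er]]]]] := Pl r Pr; subst r.
rewrite lozenge_false /= => /andP[/eqP ei /eqP ej]; subst i' j'.
exists a, b; split=> // a' b'; apply/idP/andP=> [Pr'|[/eqP -> /eqP ->]] //.
have mem c d : (Ordinal lti, Ordinal ltj, false) \in lozenge N M i j c d.
  by rewrite lozenge_false !eqxx.
have [_ _ -> ->] := lozenge_inj fit (Pu _ _ _ Pr Pr' (mem _ _) (mem _ _)).
by rewrite !eqxx.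
Qed.

Lemma tiling_true (N M i j : nat) (P : {set {set triangle N M}}) :
  is_tiling P -> in_range N M i j (i + j) ->
  exists a b : bool, [/\ ~~ (a && b), (a <= i)%N, (b <= j)%N &
    forall a' b' : bool, (a' <= i)%N -> (b' <= j)%N ->
      (lozenge N M (i - a') (j - b') a' b' \in P) = (a' == a) && (b' == b)].
Proof.
move=> tP /and3P[lti ltj rg]; have /tilingP[Pl Pc Pu] := tP.
have [|r Pr] := Pc (Ordinal lti, Ordinal ltj, true).
  by rewrite mem_hexagon addn0.
have [i' [j' [a [b [fit er]]]]] := Pl r Pr; subst r.
rewrite lozenge_true /= => /andP[/eqP ei /eqP ej].
exists a, b; split=> [|||a' b' lea leb].
- by case/andP: fit.
- by rewrite ei leq_addl.
- by rewrite ej leq_addl.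
apply/idP/andP=> [Pr'|[/eqP -> /eqP ->]]; last by rewrite ei ej !addnK.
have mem (c d : bool) k l : i = (k + c)%N -> j = (l + d)%N ->
    (Ordinal lti, Ordinal ltj, true) \in lozenge N M k l c d.
  by move=> ek el; rewrite lozenge_true /= -ek -el !eqxx.
have mem' := mem a' b' _ _ (esym (subnK lea)) (esym (subnK leb)).
have [_ _ -> ->] := lozenge_inj fit (Pu _ _ _ Pr Pr' (mem _ _ _ _ ei ej) mem').
by rewrite !eqxx.
Qed.

Lemma crossingE (N M i : nat) (j : 'I_(N + M)) (P : {set {set triangle N M}}) :
  (j \in crossing P i) = (0 < i)%N && (lozenge N M i.-1 j true false \in P).
Proof. by rewrite inE. Qed.

(** The two equations count the covers of (i, j, true) and of (i, j, false). For a triangle outside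
    of the hexagon, [paired_below] alone contributes the 1. *)
Lemma tiling_rel (N M i : nat) (j : 'I_(N + M)) (P : {set {set triangle N M}}) :
  is_tiling P -> (i < 2 * N)%N ->
  (paired_below P i j + (lozenge N M i j false false \in P) + (j \in crossing P i) = 1)%N /\
  (paired_below P i j.+1 + (lozenge N M i j false false \in P)
   + (j \in crossing P i.+1) = 1)%N.
Proof.
move=> tP lti; rewrite !crossingE /paired_below /=.
have notP a b : ~~ fits N M i j a b -> (lozenge N M i j a b \in P) = false.
  by move=> nf; apply: contraNF nf => /(tiling_fits tP).
split.
  have [rg | nrg] := boolP (N <= i + j < 2 * N + M)%N; last first.
    rewrite notP; last by rewrite /fits /in_range !addn0 (negPf nrg) !andbF.
    case: (posnP i) => [->|i_gt0] //=.
    rewrite (_ : _ \in P = false) //; apply: contraNF nrg => /(tiling_fits tP).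
    by case/and3P=> _ _ /and3P[_ _]; rewrite addn0 addn1 prednK.
  have [|a [b [nab lea leb PE]]] := @tiling_true N M i j P tP.
    by rewrite /in_range lti ltn_ord rg.
  have := PE false false; rewrite !subn0 => -> //=.
  have -> : (0 < j)%N && (lozenge N M i j.-1 false true \in P) = b.
    case: (posnP j) => [j0 | j_gt0] /=; first by move: leb; rewrite j0; case: b {PE nab}.
    have := PE false true; rewrite subn0 subn1 => -> //.
    by move: nab; case: a {PE lea}; case: b {leb}.
  have -> : (0 < i)%N && (lozenge N M i.-1 j true false \in P) = a.
    case: (posnP i) => [i0 | i_gt0] /=; first by move: lea; rewrite i0; case: a {PE nab}.
    have := PE true false; rewrite subn0 subn1 => -> //.
    by move: nab; case: a {PE lea}; case: b {leb}.
  by move: nab; case: a {PE lea}; case: b {leb}.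
rewrite addnS.
have [rg | nrg] := boolP (N <= (i + j).+1 < 2 * N + M)%N; last first.
  by rewrite !notP // /fits /in_range (negPf nrg) !andbF.
have [|a [b [fit PE]]] := @tiling_false N M i j P tP.
  by rewrite /in_range lti ltn_ord rg.
rewrite !PE /=; case/andP: fit => nab _; move: nab.
by case: a {PE}; case: b.
Qed.

Lemma paired_below0 (N M i : nat) (P : {set {set triangle N M}}) :
  (i < 2 * N)%N -> paired_below P i 0 = (i < N)%N.
Proof. move=> lti; rewrite /paired_below ltnn orbF; lia. Qed.

Lemma paired_below_top (N M i : nat) (P : {set {set triangle N M}}) :
  is_tiling P -> (i < 2 * N)%N -> paired_below P i (N + M) = (N <= i)%N.
Proof.
move=> tP lti; rewrite /paired_below.
rewrite (_ : (_ && (_ \in P)) = false); first by rewrite orbF; lia.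
apply/negP=> /andP[pos /(tiling_fits tP)/and3P[_ _ /and3P[_]]].
by rewrite addn1 prednK // ltnn.
Qed.

(** Subtracting the two equations of [tiling_rel] eliminates the lozenge inside the cell: what
    remains telescopes in [j], starting from [paired_below0]. *)
Lemma paired_below_count (N M i j : nat) (P : {set {set triangle N M}}) :
  is_tiling P -> (i < 2 * N)%N -> (j <= N + M)%N ->
  (paired_below P i j + below (crossing P i.+1) j
   = (i < N) + below (crossing P i) j)%N.
Proof.
move=> tP lti; elim: j => [|j IH] ltj; first by rewrite paired_below0 // !below0.
have e1 := belowS (crossing P i) (Ordinal ltj).
have e2 := belowS (crossing P i.+1) (Ordinal ltj).
have [r1 r2] := @tiling_rel N M i (Ordinal ltj) P tP lti.
have := IH (ltnW ltj); move: e1 e2 r1 r2 => /= -> ->.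
by case: (_ \in P); case: (_ \in crossing P i); case: (_ \in crossing P i.+1); lia.
Qed.

Lemma crossing_column (N M i : nat) (P : {set {set triangle N M}}) :
  is_tiling P -> (i < 2 * N)%N -> column i (crossing P i) (crossing P i.+1).
Proof.
move=> tP lti; apply/andP; split.
  apply/forallP=> j; have := paired_below_count tP lti (ltnW (ltn_ord j)).
  have := belowS (crossing P i) j.
have [] := @tiling_rel N M i j P tP lti; move=> + _ -> +.
by case: (_ \in P); case: (_ \in crossing P i); lia.
have := paired_below_count tP lti (leqnn _); rewrite paired_below_top //.
rewrite !below_size //; lia.
Qed.

Lemma crossing0 (N M : nat) (P : {set {set triangle N M}}) : crossing P 0 = set0.
Proof. by apply/setP=> j; rewrite !inE. Qed.

Lemma crossing_last (N M : nat) (P : {set {set triangle N M}}) :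
  is_tiling P -> crossing P (2 * N) = set0.
Proof.
move=> tP; apply/setP=> j; rewrite !inE; apply/negP=> /andP[pos].
by move/(tiling_fits tP)/and3P=> [_ _ /and3P[]]; rewrite addn1 prednK // ltnn.
Qed.

Lemma crossing_stacked (N M i j : nat) (P : {set {set triangle N M}}) :
  is_tiling P -> (i < 2 * N)%N -> (j <= N + M)%N ->
  stacked i (crossing P i) (crossing P i.+1) j = paired_below P i j.
Proof.
move=> tP lti lej; have := paired_below_count tP lti lej; rewrite /stacked; lia.
Qed.

Lemma tiling_lozenge (N M i : nat) (j : 'I_(N + M)) (a b : bool)
    (P : {set {set triangle N M}}) :
  is_tiling P -> lozenge N M i j a b \in P ->
  a = (j \in crossing P i.+1) /\
  b = stacked i (crossing P i) (crossing P i.+1) j.+1.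
Proof.
move=> tP Pr; have /and3P[nab /and3P[lti ltj rg] _] := tiling_fits tP Pr.
rewrite crossing_stacked //.
have [_] := @tiling_rel N M i j P tP lti.
rewrite crossingE /paired_below /= addnS rg /=.
by case: a b nab Pr => [] [] //= _ ->; lia.
Qed.

Definition crossings_ok (N M : nat) (X : nat -> {set 'I_(N + M)}) : Prop :=
  [/\ X 0%N = set0, X (2 * N)%N = set0
    & forall i, (i < 2 * N)%N -> column i (X i) (X i.+1)].

(** Every triangle of type [false] in the hexagon chooses its partner: across the vertical edge if
    the crossing set says so, above if the triangle there is stacked, and inside its own cell
    otherwise. *)
Definition of_crossings (N M : nat) (X : nat -> {set 'I_(N + M)}) :
  {set {set triangle N M}} :=
  [set r | [exists i : 'I_(2 * N), [exists j : 'I_(N + M),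
     (N <= (i + j).+1 < 2 * N + M)%N &&
     (r == lozenge N M i j (j \in X i.+1) (stacked i (X i) (X i.+1) j.+1))]]].

Lemma of_crossingsP (N M : nat) (X : nat -> {set 'I_(N + M)}) (r : {set triangle N M}) :
  reflect (exists i : nat, exists j : 'I_(N + M), [/\ (i < 2 * N)%N,
            (N <= (i + j).+1 < 2 * N + M)%N
          & r = lozenge N M i j (j \in X i.+1) (stacked i (X i) (X i.+1) j.+1)])
          (r \in of_crossings X).
Proof.
rewrite inE; apply: (iffP existsP) => [[i /existsP[j /andP[rg /eqP ->]]]|].
  by exists i, j; split.
case=> i [j [lti rg ->]]; exists (Ordinal lti); apply/existsP; exists j.
by rewrite rg eqxx.
Qed.

Lemma below_gt0 (n j : nat) (X : {set 'I_n}) :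
  (0 < below X j)%N -> exists2 x, x \in X & (x < j)%N.
Proof. by case/card_gt0P=> x; rewrite inE => /andP[]; exists x. Qed.

Lemma below_lt (n j : nat) (X : {set 'I_n}) :
  (below X j < #|X|)%N -> exists2 x, x \in X & (j <= x)%N.
Proof.
move=> lt; have [/existsP[x /andP[Xx jx]]|/existsPn none] :=
  boolP [exists x, (x \in X) && (j <= x)%N]; first by exists x.
rewrite below_size ?ltnn // in lt.
by move=> x Xx; have := none x; rewrite Xx -ltnNge.
Qed.

(** [column] knows nothing of the sides of the hexagon; they are forced. Left of the axis, each
    element of a set has a strictly smaller one in the next set, and the induction is on the
    distance to the axis. [crossings_upper] is the mirror argument, with strictly larger elements in
    the previous set. *)
Lemma crossings_lower (N M : nat) (X : nat -> {set 'I_(N + M)}) :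
  crossings_ok X -> forall i (j : 'I_(N + M)), (i <= N)%N -> j \in X i -> (N <= i + j)%N.
Proof.
case=> _ _ col i j leiN; rewrite -leq_subLR.
have [k ek] : exists k, k = (N - i)%N by exists (N - i)%N.
rewrite -ek; elim: k i j leiN ek => [//|k IH] i j leiN ek Xj.
have /andP[/forallP/(_ j)/andP[_ c2] _] : column i (X i) (X i.+1) by apply: col; lia.
have [|z Xz ltz] := @below_gt0 _ j (X i.+1).
  by move: c2; rewrite belowS Xj; lia.
have := IH i.+1 z _ _ Xz; lia.
Qed.

Lemma crossings_upper (N M : nat) (X : nat -> {set 'I_(N + M)}) :
  crossings_ok X -> forall i (j : 'I_(N + M)), (N <= i <= 2 * N)%N -> j \in X i ->
  (i + j < 2 * N + M)%N.
Proof.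
case=> _ _ col i j /andP[/subnKC <-]; move: (i - N)%N => k {i}.
elim: k j => [|k IH] j lek Xj; first by have := ltn_ord j; lia.
rewrite addnS in lek Xj *.
have /andP[/forallP/(_ j)/andP[_ c2] /eqP sz] := col _ lek.
have [|y Xy lty] := @below_lt _ j.+1 (X (N + k)%N).
  have := below_le (X (N + k).+1) j.+1; rewrite belowS Xj; lia.
have := IH y (ltnW lek) Xy; lia.
Qed.

(** Below the hexagon both counts vanish, and above it both are full, so the equation of [stacked]
    reduces to one on cardinals. *)
Lemma crossings_frozen (N M : nat) (X : nat -> {set 'I_(N + M)}) (i j : nat) :
  crossings_ok X -> (i < 2 * N)%N -> (j <= N + M)%N ->
  ~~ (N <= i + j < 2 * N + M)%N -> stacked i (X i) (X i.+1) j.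
Proof.
move=> ok lti lej nrg; have [_ _ col] := ok; rewrite /stacked.
case: (ltnP (i + j) N) nrg => [lt _|ge] /=.
  rewrite /below !eq_card0; first lia.
    move=> x; rewrite inE; apply/negP=> /andP[Xx ltx].
    by have := crossings_lower ok (_ : i.+1 <= N)%N Xx; lia.
  move=> x; rewrite inE; apply/negP=> /andP[Xx ltx].
  by have := crossings_lower ok (_ : i <= N)%N Xx; lia.
rewrite -leqNgt => ge2; have /andP[_ /eqP sz] := col _ lti.
rewrite !below_size; first lia.
  by move=> x Xx; have := crossings_upper ok (_ : N <= i.+1 <= 2 * N)%N Xx; lia.
by move=> x Xx; have := crossings_upper ok (_ : N <= i <= 2 * N)%N Xx; lia.
Qed.

Lemma of_crossings_fits (N M i : nat) (X : nat -> {set 'I_(N + M)}) (j : 'I_(N + M)) :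
  crossings_ok X -> (i < 2 * N)%N -> (N <= (i + j).+1 < 2 * N + M)%N ->
  fits N M i j (j \in X i.+1) (stacked i (X i) (X i.+1) j.+1).
Proof.
move=> ok lti rg; have [_ X2N col] := ok; have [rel nab] := stacked_rel j (col _ lti).
rewrite /fits nab /in_range lti ltn_ord rg /=.
case Xj: (j \in X i.+1) nab rel => /=.
  move/negPf=> -> _; rewrite addn0 addn1 addSn rg ltn_ord !andbT.
  rewrite ltn_neqAle lti andbT; apply/eqP=> ei.
  by rewrite ei X2N inE in Xj.
move=> _; case st: (stacked _ _ _ j.+1) => /=.
  rewrite !addn0 addn1 addnS lti rg !andbT => _.
  rewrite ltn_neqAle ltn_ord andbT; apply/negP=> /eqP ej.
  by move: st; rewrite ej stacked_top; [lia | exact: col].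
rewrite !addn0 lti ltn_ord /= => rel; apply: contraTT isT => nrg.
by move: rel; rewrite crossings_frozen // ltnW.
Qed.

Lemma of_crossings_tiling (N M : nat) (X : nat -> {set 'I_(N + M)}) :
  crossings_ok X -> is_tiling (of_crossings X).
Proof.
move=> ok; have [X0 X2N col] := ok; apply/tilingP; split.
- move=> r /of_crossingsP[i [j [lti rg ->]]].
  exists i, j, (j \in X i.+1), (stacked i (X i) (X i.+1) j.+1).
  by split=> //; apply: of_crossings_fits.
- case=> [[i j] []]; rewrite mem_hexagon ?addn0 ?addn1 => rg; last first.
    exists (lozenge N M i j (j \in X i.+1) (stacked i (X i) (X i.+1) j.+1)).
      by apply/of_crossingsP; exists i, j; split.
    by rewrite lozenge_false !eqxx.
  have [rel _] := stacked_rel j (col _ (ltn_ord i)).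
  have : [|| stacked i (X i) (X i.+1) j,
             ~~ stacked i (X i) (X i.+1) j.+1 && (j \notin X i.+1) | j \in X i].
    by move: rel; case: (j \in X i); case: (stacked _ _ _ j); case: (_ && _).
  case/or3P=> [st | /andP[/negPf nst /negPf nX] | Xj].
  + have j_gt0 : (0 < j)%N.
      rewrite lt0n; apply/negP=> /eqP j0; move: st; rewrite j0 stacked0; lia.
    have ltj : (j.-1 < N + M)%N by have := ltn_ord j; lia.
    have [_] := stacked_rel (Ordinal ltj) (col _ (ltn_ord i)).
    rewrite /= prednK // st andbT => nX.
    exists (lozenge N M i j.-1 false true).
      apply/of_crossingsP; exists i, (Ordinal ltj).
      by rewrite /= -addnS prednK // st (negPf nX); split.
    by rewrite lozenge_true addn0 addn1 prednK // !eqxx.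
  + exists (lozenge N M i j false false).
      apply/of_crossingsP; exists i, j; rewrite nst nX; split=> //.
      case/andP: rg => rg1 rg2; rewrite (leq_trans rg1) //= ltn_neqAle rg2 andbT.
      apply/negP=> /eqP e; move: nst; rewrite crossings_frozen //.
      by rewrite addnS e ltnn andbF.
    by rewrite lozenge_true !addn0 !eqxx.
  + have i_gt0 : (0 < i)%N.
      by rewrite lt0n; apply/negP=> /eqP i0; move: Xj; rewrite i0 X0 inE.
    have lti : (i.-1 < 2 * N)%N by have := ltn_ord i; lia.
    have [_] := stacked_rel j (col _ lti).
    rewrite /= prednK // Xj /= => /negPf nst.
    exists (lozenge N M i.-1 j true false).
      apply/of_crossingsP; exists i.-1, j.
      by split=> //; rewrite -?addSn prednK // Xj nst.
    by rewrite lozenge_true addn0 addn1 prednK // !eqxx.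
move=> t r r' /of_crossingsP[i [j [lti rg ->]]] /of_crossingsP[i' [j' [lti' rg' ->]]].
case: t => [[k l] []]; last first.
  rewrite !lozenge_false => /andP[/eqP <- /eqP/val_inj <-].
  by move=> /andP[/eqP <- /eqP/val_inj <-].
(* Both flags of a lozenge that contains the triangle (k, l, true) can be read off (k, l) alone; as
   they determine the position of the lozenge, it is unique. *)
have key i1 (j1 : 'I_(N + M)) : (i1 < 2 * N)%N ->
    (k, l, true) \in lozenge N M i1 j1 (j1 \in X i1.+1) (stacked i1 (X i1) (X i1.+1) j1.+1) ->
    (j1 \in X i1.+1) = (l \in X k) /\
    stacked i1 (X i1) (X i1.+1) j1.+1 = stacked k (X k) (X k.+1) l.
  move=> lti1; rewrite lozenge_true.
  have [rel1 nab1] := stacked_rel j1 (col _ lti1).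
  have [rel _] := stacked_rel l (col _ (ltn_ord k)).
  case Xj1: (j1 \in X i1.+1) nab1 rel1 => /=.
    move/negPf=> st1 _; rewrite st1 addn0 addn1 => /andP[/eqP ek /eqP/val_inj el].
    move: rel; rewrite el ek Xj1; case: (stacked _ _ _ _) => //.
    by case: (_ && _).
  move=> _; case st1: (stacked _ _ _ j1.+1) => /= rel1.
    rewrite addn0 addn1 => /andP[/eqP ek /eqP el].
    by move: rel; rewrite el ek st1; case: (_ \in X i1); case: (_ && _).
  rewrite !addn0 => /andP[/eqP ek /eqP/val_inj el].
  move: rel; rewrite el ek st1 Xj1 /=.
  by case: (stacked _ _ _ _); case: (_ \in _).
move=> tr tr'; have [a1 b1] := key _ _ lti tr; have [a2 b2] := key _ _ lti' tr'.
move: tr tr'; rewrite a1 a2 b1 b2 !lozenge_true => /andP[/eqP e1 /eqP e2] /andP[/eqP e3 /eqP e4].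
have -> : i = i' by apply: (@addIn (l \in X k)); rewrite -e1.
have -> // : j = j' :> nat by apply: (@addIn (stacked k (X k) (X k.+1) l)); rewrite -e2.
Qed.

Lemma of_crossingsK (N M : nat) (X : nat -> {set 'I_(N + M)}) (i : nat) :
  crossings_ok X -> (i <= 2 * N)%N -> crossing (of_crossings X) i = X i.
Proof.
move=> ok lei; have [X0 X2N col] := ok; apply/setP=> j; rewrite crossingE.
case: i lei => [|i] lti /=; first by rewrite X0 inE.
apply/of_crossingsP/idP=> [[i' [j' [lti' rg' e]]]|Xj].
  have fit := of_crossings_fits ok lti' rg'.
  by have [-> /val_inj -> <- _] := lozenge_inj fit (esym e).
have [_] := stacked_rel j (col _ lti); rewrite Xj /= => /negPf st.
exists i, j; rewrite Xj st; split=> //.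
have [leN|leN] := leqP i.+1 N.
  by rewrite (crossings_lower ok leN Xj) /=; have := ltn_ord j; lia.
have := crossings_upper ok (_ : N <= i.+1 <= 2 * N)%N Xj; lia.
Qed.

Lemma crossingK (N M : nat) (P : {set {set triangle N M}}) :
  is_tiling P -> of_crossings (crossing P) = P.
Proof.
move=> tP; apply/setP=> r; apply/of_crossingsP/idP=> [[i [j [lti rg ->]]]|Pr].
  have [|a [b [_ PE]]] := @tiling_false N M i j P tP.
    by rewrite /in_range lti ltn_ord rg.
  have Pab : lozenge N M i j a b \in P by rewrite PE !eqxx.
  by have [<- <-] := tiling_lozenge tP Pab.
have /tilingP[Pl _ _] := tP.
have [i [j [a [b [fit er]]]]] := Pl r Pr; subst r.
have /and3P[_ /and3P[lti ltj rg] _] := fit.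
exists i, (Ordinal ltj); split=> //.
by have [<- <-] := @tiling_lozenge N M i (Ordinal ltj) a b P tP Pr.
Qed.

Lemma crossing_ok (N M : nat) (P : {set {set triangle N M}}) :
  is_tiling P -> crossings_ok (crossing P).
Proof.
move=> tP; split; [exact: crossing0 | exact: crossing_last |].
by move=> i; apply: crossing_column.
Qed.

(** The symmetry axis is the right edge of column N - 1, since [i] is the abscissa shifted by N. *)
Lemma axis_lozenge (N M l : nat) :
  (0 < N)%N -> axis_rhombus N M l = lozenge N M N.-1 l true false.
Proof.
move=> N_gt0; apply/setP=> -[[i j] d]; have := ltn_ord i; have := ltn_ord j.
by case: d; rewrite ?lozenge_true ?lozenge_false inE /= !inE !xpair_eqE; lia.
Qed.

(** * Counting tilings as walks from column to column *)

Definition walk (S : finType) (st : nat -> S -> S -> bool) (a b : S) (n : nat) :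
  {set {ffun 'I_n.+1 -> S}} :=
  [set x : {ffun 'I_n.+1 -> S} | [&& x ord0 == a, x ord_max == b
     & [forall i : 'I_n, st i (x (inord i)) (x (inord i.+1))]]].

Fixpoint walks (S : finType) (st : nat -> S -> S -> bool) (a : S) (n : nat) (b : S) : nat :=
  if n is n1.+1 then (\sum_(c | st n1 c b) walks st a n1 c)%N else (a == b).

Lemma card_walk (S : finType) (st : nat -> S -> S -> bool) (a b : S) (n : nat) :
  #|walk st a b n| = walks st a n b.
Proof.
elim: n b => [|n IH] b /=.
  have [<-|ab] := eqVneq a b.
    rewrite (_ : walk _ _ _ _ = [set [ffun => a]]) ?cards1 //.
    apply/setP=> x; rewrite !inE; apply/and3P/eqP => [[/eqP x0 _ _]|->].
      by apply/ffunP=> i; rewrite ffunE -x0 (ord1 i).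
    by rewrite !ffunE; split=> //; apply/forallP=> -[].
  apply: eq_card0 => x; rewrite !inE; apply/negP=> /and3P[/eqP xa /eqP xb _].
  by rewrite -xa -xb (ord1 ord_max) eqxx in ab.
pose ext (y : {ffun 'I_n.+1 -> S}) : {ffun 'I_n.+2 -> S} :=
  [ffun i : 'I_n.+2 => if (i <= n)%N then y (inord i) else b].
have extE y i : (i <= n)%N -> ext y (inord i) = y (inord i).
  by move=> lei; rewrite ffunE inordK ?lei // ltnS leqW.
have ext_inj : injective ext.
  move=> y z eyz; apply/ffunP=> i.
  by rewrite -(inord_val i) -!extE ?eyz // -ltnS.
rewrite -sum1_card (partition_big (fun x : {ffun _} => x (inord n)) (fun c => st n c b)) /=.
  apply: eq_bigr => c st_c; rewrite -IH -(card_imset _ ext_inj) -sum1_card.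
  apply: eq_bigl => x; rewrite !inE.
  apply/andP/imsetP=> [[/and3P[/eqP x0 /eqP xb /forallP xs] /eqP xn]|[y]].
    exists [ffun i : 'I_n.+1 => x (inord i)].
      rewrite !inE !ffunE /= xn eqxx (_ : inord 0 = ord0); last first.
        by apply: val_inj; rewrite /= inordK.
      rewrite x0 eqxx; apply/forallP=> i; rewrite !ffunE !inordK ?ltnS //; last exact: ltnW.
      exact: xs (widen_ord (leqnSn n) i).
    apply/ffunP=> i; rewrite !ffunE; case: leqP => lei.
      by rewrite inordK ?ltnS // inord_val.
    rewrite -xb; congr (x _); apply: val_inj => /=; apply/eqP.
    by rewrite eqn_leq lei -ltnS ltn_ord.
  rewrite !inE => /and3P[/eqP y0 /eqP yc /forallP ys] ->.
  rewrite extE // (_ : inord n = ord_max) ?yc ?eqxx; last by apply: val_inj; rewrite /= inordK.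
  split=> //; apply/and3P; split.
  - by rewrite ffunE /= (_ : inord 0 = ord0) ?y0 //; apply: val_inj; rewrite /= inordK.
  - by rewrite ffunE /= ltnn.
  apply/forallP=> i; have lei : (i <= n)%N by rewrite -ltnS.
  rewrite extE //; have [lti|] := ltnP i n; first by rewrite extE //; exact: (ys (Ordinal lti)).
  move=> lni; have ei : i = n :> nat by apply/eqP; rewrite eqn_leq lei lni.
  rewrite ei ffunE inordK // ltnn (_ : inord n = ord_max) ?yc //.
  by apply: val_inj; rewrite /= inordK.
move=> x; rewrite inE => /and3P[_ /eqP xb /forallP/(_ ord_max)] /=.
rewrite (_ : inord n.+1 = ord_max) ?xb //.
by apply: val_inj; rewrite /= inordK.
Qed.

(** The requirement on the axis rhombus is attached to the step that arrives at the axis, so that it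
    becomes part of the transition relation. *)
Definition column_through (N M : nat) (l : nat) (i : nat) (Y Z : {set 'I_(N + M)}) :=
  column i Y Z && ((i.+1 == N) ==> [exists j in Z, j == l :> nat]).

Lemma A_walks (N M : nat) :
  (0 < N)%N ->
  A N M = walks (@column_through N M (N + M)./2) set0 (2 * N) set0.
Proof.
move=> N_gt0; rewrite -card_walk /A.
set Ts := [set P | _]; set W := walk _ _ _ _.
pose toW (P : {set {set triangle N M}}) : {ffun 'I_(2 * N).+1 -> {set 'I_(N + M)}} :=
  [ffun i : 'I_(2 * N).+1 => crossing P i].
pose toT (x : {ffun 'I_(2 * N).+1 -> {set 'I_(N + M)}}) :=
  of_crossings (fun i => x (inord i)).
have lt_mid : ((N + M)./2 < N + M)%N by lia.
have midE P : ([exists j in crossing P N, j == (N + M)./2 :> nat])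
    = (axis_rhombus N M (N + M)./2 \in P).
  rewrite axis_lozenge //; apply/exists_inP/idP=> [[j + /eqP <-]|Pl].
    by rewrite crossingE => /andP[].
  by exists (Ordinal lt_mid); rewrite ?crossingE ?N_gt0.
have TW P : P \in Ts -> toW P \in W /\ toT (toW P) = P.
  rewrite inE => /andP[tP mid]; have [P0 P2N col] := crossing_ok tP.
  have toWE i : (i <= 2 * N)%N -> toW P (inord i) = crossing P i.
    by move=> lei; rewrite ffunE inordK.
  split; last first.
    rewrite -[RHS](crossingK tP); apply/setP=> r.
    by apply/of_crossingsP/of_crossingsP=> -[i [j [lti rg ->]]];
       exists i, j; rewrite !toWE // ltnW.
  rewrite inE !ffunE /= P0 P2N !eqxx /=; apply/forallP=> i.
  rewrite !toWE // 1?ltnW // /column_through col //=.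
  by apply/implyP=> /eqP ei; rewrite ei midE.
have WT x : x \in W -> toT x \in Ts /\ toW (toT x) = x.
  rewrite inE => /and3P[/eqP x0 /eqP xN /forallP xs].
  have ok : crossings_ok (fun i => x (inord i)).
    split; [rewrite -[RHS]x0 | rewrite -[RHS]xN |].
    - by congr (x _); apply: val_inj; rewrite /= inordK.
    - by congr (x _); apply: val_inj; rewrite /= inordK.
    by move=> i lti; have /andP[] := xs (Ordinal lti).
  have xE : toW (toT x) = x.
    apply/ffunP=> i; rewrite ffunE of_crossingsK // ?inord_val //.
    by rewrite -ltnS.
  split=> //; rewrite inE of_crossings_tiling //= -midE.
  have lt1 : (N.-1 < 2 * N)%N by lia.
  have /andP[_] := xs (Ordinal lt1); rewrite /= prednK // eqxx /=.
  rewrite of_crossingsK //; lia.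
(* Each of the two sets lies in the image of the other, which gives both inequalities between the
   cardinals. *)
apply/eqP; rewrite eqn_leq; apply/andP; split.
  have/subset_leq_card le : Ts \subset toT @: W.
    by apply/subsetP=> P /TW[WP {1}<-]; apply: imset_f.
  exact: leq_trans le (leq_imset_card _ _).
have/subset_leq_card le : W \subset toW @: Ts.
  by apply/subsetP=> x /WT[Tx {1}<-]; apply: imset_f.
exact: leq_trans le (leq_imset_card _ _).
Qed.

(** * Half tilings and determinants *)

Definition pos (n : nat) (X : {set 'I_n}) (i : nat) : nat :=
  nth 0%N (map val (enum X)) i.

Lemma sorted_enum (n : nat) (X : {set 'I_n}) : sorted ltn (map val (enum X)).
Proof.
rewrite sorted_map /enum_mem.
apply: sorted_filter => [x y z|]; first exact: ltn_trans.
by have := iota_ltn_sorted 0 n; rewrite -val_enum_ord sorted_map enumT.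
Qed.

Lemma size_map_enum (n : nat) (X : {set 'I_n}) : size (map val (enum X)) = #|X|.
Proof. by rewrite size_map cardE. Qed.

Lemma count_lt_sorted (s : seq nat) (i j : nat) :
  sorted ltn s -> (i < size s)%N ->
  (i < count (fun x => x < j) s)%N = (nth 0 s i < j)%N.
Proof.
elim: s i => [//|a s IH] i srt lti; have srt' := path_sorted srt.
have /allP all_gt := order_path_min ltn_trans srt; rewrite [count _ _]/=.
have [ltaj | leja] := ltnP a j; first by case: i lti => [|i] //= lti; rewrite add1n ltnS IH.
have -> : count (fun x => x < j)%N s = 0%N.
  apply/eqP; rewrite -[_ == _]negbK -lt0n -has_count; apply/hasPn=> x /all_gt /=.
  by move=> ltax; rewrite -leqNgt ltnW // (leq_ltn_trans leja).
rewrite ltn0; case: i lti => [|i] lti /=; first by rewrite ltnNge leja.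
by have /all_gt /= := mem_nth 0%N (lti : (i < size s)%N); lia.
Qed.

(** The Galois-type equivalence that translates inequalities between counts into inequalities
    between positions. *)
Lemma below_pos (n : nat) (X : {set 'I_n}) (i j : nat) :
  (i < #|X|)%N -> (i < below X j)%N = (pos X i < j)%N.
Proof.
rewrite -size_map_enum => lti; rewrite -(count_lt_sorted _ (sorted_enum X) lti).
congr (_ < _)%N; rewrite /below cardE count_map -size_filter.
apply/perm_size/uniq_perm; [exact: enum_uniq | exact/filter_uniq/enum_uniq | move=> x].
by rewrite mem_enum inE mem_filter mem_enum andbC.
Qed.

Lemma pos_lt (n : nat) (X : {set 'I_n}) (i j : nat) :
  (i < j)%N -> (j < #|X|)%N -> (pos X i < pos X j)%N.
Proof.
rewrite -size_map_enum => ltij ltj.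
by apply: (sorted_ltn_nth ltn_trans 0%N (sorted_enum X)); rewrite ?inE // (ltn_trans ltij).
Qed.

Lemma pos_mem (n : nat) (X : {set 'I_n}) (i : nat) :
  (i < #|X|)%N -> exists2 x, x \in X & pos X i = x.
Proof.
rewrite -size_map_enum => lti.
have /mapP[x + e] := mem_nth 0%N lti; rewrite mem_enum => Xx.
by exists x.
Qed.

Lemma pos_imset (n k : nat) (y : 'I_k -> 'I_n) :
  {homo y : i j / (i < j)%N} ->
  #|y @: setT| = k /\ forall i : 'I_k, pos (y @: setT) i = y i.
Proof.
move=> y_lt; have y_inj : injective y.
  by move=> i j eyij; case: (ltngtP i j) => [/y_lt|/y_lt|/val_inj //]; rewrite eyij ltnn.
have card_y : #|y @: setT| = k by rewrite card_imset // cardsT card_ord.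
split=> // i; rewrite /pos.
have -> : map val (enum (y @: setT)) = [seq val (y j) | j <- enum 'I_k].
  apply: (irr_sorted_eq ltn_trans ltnn (sorted_enum _)).
    rewrite sorted_map; have := iota_ltn_sorted 0 k.
    by rewrite -val_enum_ord sorted_map; apply: sub_sorted => a b; apply: y_lt.
  move=> v; apply/mapP/mapP=> [[x + ->]|[j _ ->]].
    by rewrite mem_enum => /imsetP[j _ ->]; exists j; rewrite ?mem_enum.
  by exists (y j); rewrite // mem_enum imset_f.
by rewrite (nth_map i) ?size_enum_ord // nth_ord_enum.
Qed.

(* [c = 1] is the relation in the left half of the hexagon and [c = 0] the one
   in the right half. *)
Definition interlace (n c : nat) (B S : {set 'I_n}) : bool :=
  (#|B| == #|S|.+1) &&
  [forall i : 'I_n, (i < #|S|)%N ==> (pos B i + c <= pos S i < pos B i.+1 + c)%N].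

Lemma interlaceP (n c : nat) (B S : {set 'I_n}) :
  reflect (#|B| = #|S|.+1 /\
           forall i, (i < #|S|)%N -> (pos B i + c <= pos S i < pos B i.+1 + c)%N)
          (interlace c B S).
Proof.
apply: (iffP andP) => -[eqS]; last first.
  by move=> itl; rewrite eqS; split=> //; apply/forallP=> i; apply/implyP=> /itl.
move/forallP=> itl; split=> [|i lti]; first exact/eqP.
have ltn : (i < n)%N by rewrite (leq_trans lti) // -[n in (_ <= n)%N]card_ord max_card.
exact: (implyP (itl (Ordinal ltn))).
Qed.

Lemma column_below (N M i : nat) (Y Z : {set 'I_(N + M)}) (j : nat) :
  column i Y Z ->
  (below Z j <= (i < N) + below Y j)%N /\ ((i < N) + below Y j.+1 <= 1 + below Z j)%N.
Proof.
case/andP=> /forallP col /eqP sz; case: (ltnP j (N + M)) => [lt|ge].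
  by have /andP[] := col (Ordinal lt).
rewrite !below_size => [|x _|x _|x _]; try by have := ltn_ord x; lia.
lia.
Qed.

Lemma column_left (N M i : nat) (Y Z : {set 'I_(N + M)}) :
  (i < N)%N -> column i Y Z = interlace 1 Z Y.
Proof.
move=> ltiN; apply/idP/interlaceP=> [col|[sz itl]].
  have sz : #|Z| = #|Y|.+1 by move: col; rewrite /column ltiN => /andP[_ /eqP]; lia.
  split=> // k ltk; have ltkZ : (k.+1 < #|Z|)%N by rewrite sz.
  have [] := column_below (pos Y k) col; rewrite ltiN !add1n ltnS => c1 c2.
  rewrite !addn1 ltnS -(below_pos _ (ltnW ltkZ)) (leq_trans _ c2) ?below_pos //=.
  rewrite leqNgt -(below_pos _ ltkZ); apply/negP=> /leq_trans/(_ c1).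
  by rewrite ltnS below_pos // ltnn.
rewrite /column ltiN sz; apply/andP; split; last by rewrite leqNgt ltiN addn0 add1n.
(* If a counting inequality failed at [j], the smaller count would be an index at which the
   interlacing fails. *)
apply/forallP=> j; apply/andP; split; rewrite ?add1n ?ltnS leqNgt; apply/negP=> lt.
  have ltkZ := leq_trans lt (below_le Z j); have ltk := ltkZ; rewrite sz ltnS in ltk.
  rewrite below_pos // in lt; have /andP[_] := itl _ ltk.
  by rewrite addn1 ltnS => /leq_ltn_trans/(_ lt); rewrite -below_pos // ltnn.
have ltk := leq_trans lt (below_le Y j.+1).
rewrite below_pos // ltnS in lt; have /andP[+ _] := itl _ ltk.
rewrite addn1 => /leq_trans/(_ lt); rewrite -below_pos ?ltnn // sz.
exact: ltnW.
Qed.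

Lemma column_right (N M i : nat) (Y Z : {set 'I_(N + M)}) :
  (N <= i)%N -> column i Y Z = interlace 0 Y Z.
Proof.
move=> geN; have geiN : (i < N)%N = false by rewrite ltnNge geN.
apply/idP/interlaceP=> [col|[sz itl]].
  have sz : #|Y| = #|Z|.+1.
    by move: col; rewrite /column geN geiN => /andP[_ /eqP]; rewrite add0n addn1.
  split=> // k ltk; have ltkY : (k.+1 < #|Y|)%N by rewrite sz.
  have [_] := column_below (pos Z k) col; rewrite geiN !add0n !add1n => c2.
  have [] := column_below (pos Z k).+1 col; rewrite geiN !add0n => c1 _.
  rewrite !addn0 -ltnS -(below_pos _ (ltnW ltkY)) (leq_trans _ c1) ?below_pos //=.
  rewrite ltnNge -ltnS -(below_pos _ ltkY); apply/negP=> /leq_trans/(_ c2).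
  by rewrite ltnS below_pos // ltnn.
rewrite /column geN geiN sz; apply/andP; split; last by rewrite add0n addn1.
apply/forallP=> j; apply/andP; split; rewrite ?add0n ?add1n leqNgt; apply/negP=> lt.
  have ltk := leq_trans lt (below_le Z j); rewrite below_pos // in lt.
  have /andP[+ _] := itl _ ltk; rewrite addn0 => /leq_ltn_trans/(_ lt).
  by rewrite -below_pos ?ltnn // sz ltnW.
have ltkY := leq_trans lt (below_le Y j.+1); have ltk := ltkY; rewrite sz ltnS in ltk.
rewrite below_pos // ltnS in lt; have /andP[_] := itl _ ltk; rewrite addn0.
by move=> /leq_trans/(_ lt); rewrite -below_pos // ltnn.
Qed.

(** The intervals allotted to the successive elements of [S] are disjoint and increasing, so
    interlacing sets are arbitrary choices of one point per interval. The sum can then be taken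
    inside each row, the determinant being multilinear. *)
Lemma sum_interlace (n c k : nat) (B : {set 'I_n}) (F : nat -> nat -> rat) :
  #|B| = k.+1 ->
  \sum_(S | interlace c B S) \det (\matrix_(i < k, j < k) F (pos S i) j) =
  \det (\matrix_(i < k, j < k)
          \sum_(v < n | (pos B i + c <= v < pos B i.+1 + c)%N) F v j).
Proof.
move=> cardB.
pose Q (i : 'I_k) := [pred v : 'I_n | pos B i + c <= v < pos B i.+1 + c]%N.
have [x0 _] : exists x, x \in B by apply/set0Pn; rewrite -card_gt0 cardB.
transitivity (\sum_(y in family Q) \det (\matrix_(i < k, j < k) F (y i) j)).
  pose h (y : {ffun 'I_k -> 'I_n}) := y @: setT.
  pose h' (S : {set 'I_n}) := [ffun i : 'I_k => nth x0 (enum S) i].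
  have h'E (S : {set 'I_n}) (i : 'I_k) : #|S| = k -> h' S i = pos S i :> nat.
    by move=> cardS; rewrite ffunE /pos (nth_map x0) // -cardE cardS.
  have posB i j : (i <= j <= k)%N -> (pos B i <= pos B j)%N.
    case/andP; rewrite leq_eqVlt => /predU1P[->//|lt lej].
    by apply/ltnW/pos_lt; rewrite ?cardB.
  have mono y : y \in family Q -> {homo y : i j / (i < j)%N}.
    move=> /familyP yQ i j ltij; have /andP[_ lt1] := yQ i; have /andP[lt2 _] := yQ j.
    by have := posB i.+1 j; have := ltn_ord j; lia.
  rewrite (reindex_onto h h') /= => [|S /interlaceP[sz _]]; last first.
    have cardS : #|S| = k by apply: succn_inj; rewrite -sz cardB.
    apply/setP=> x; apply/imsetP/idP => [[i _ ->]|Sx].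
      by rewrite ffunE -mem_enum mem_nth // -cardE cardS.
    have lt : (index x (enum S) < k)%N by rewrite -cardS cardE index_mem mem_enum.
    by exists (Ordinal lt); rewrite // ffunE /= nth_index // mem_enum.
  have card_h y : interlace c B (h y) -> #|h y| = k.
    by case/interlaceP; rewrite cardB => -[].
  apply: eq_big => [y|y /andP[/card_h cardS /eqP yE]]; last first.
    by congr (\det _); apply/matrixP=> i j; rewrite !mxE -h'E // yE.
  apply/andP/idP => [[itl /eqP yE]|yQ].
    apply/familyP=> i; rewrite -[y]yE inE h'E ?card_h //.
    by have /interlaceP[_] := itl; apply; rewrite card_h.
  have [cardS posS] := pos_imset (mono y yQ); split.
    apply/interlaceP; rewrite cardS cardB; split=> // i lti.
    by rewrite (posS (Ordinal lti)); have /familyP := yQ; apply.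
  by apply/eqP/ffunP=> i; apply: val_inj; rewrite /= h'E.
under eq_bigr do rewrite /determinant.
rewrite exchange_big /determinant; apply: eq_bigr => s _ /=.
rewrite -big_distrr; congr (_ * _).
transitivity (\prod_(i < k) \sum_(v < n | Q i v) F v (s i)).
  by rewrite bigA_distr_big_dep; apply: eq_bigr => y _; apply: eq_bigr => i _; rewrite mxE.
by apply: eq_bigr => i _; rewrite mxE.
Qed.

(** The matrix of coefficients in the monomial basis is triangular, with the leading coefficients on
    its diagonal. *)
Lemma det_poly_family (k : nat) (p : nat -> {poly rat}) (y : nat -> rat) :
  (forall j, size (p j) = j.+1) ->
  \det (\matrix_(i < k, j < k) (p j).[y i]) =
  \prod_(j < k) lead_coef (p j) * \det (\matrix_(i < k, j < k) y i ^+ j).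
Proof.
move=> size_p; pose C := \matrix_(l < k, j < k) (p j)`_l.
have -> : \matrix_(i < k, j < k) (p j).[y i] = (\matrix_(i < k, j < k) y i ^+ j) *m C.
  apply/matrixP=> i j; rewrite !mxE (@horner_coef_wide _ k) ?size_p //.
  by apply: eq_bigr => l _; rewrite !mxE mulrC.
rewrite det_mulmx mulrC; congr (_ * _).
rewrite -det_tr det_trig; last first.
  by apply/is_trig_mxP=> i j ltij; rewrite !mxE nth_default // size_p.
by apply: eq_bigr => j _; rewrite !mxE lead_coefE size_p.
Qed.

Lemma det_pow_shift (k : nat) (c : rat) (y : nat -> rat) :
  \det (\matrix_(i < k, j < k) (y i + c) ^+ j) = \det (\matrix_(i < k, j < k) y i ^+ j).
Proof.
have monic_Xc j : ('X + c%:P) ^+ j \is monic by apply/monic_exp/monicXaddC.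
have := @det_poly_family k (fun j => ('X + c%:P) ^+ j) y.
rewrite big1 => [|j _]; last exact/monicP.
rewrite mul1r => <- => [|j]; last by rewrite -[c]opprK rmorphN size_exp_XsubC.
by congr (\det _); apply/matrixP=> i j; rewrite !mxE horner_exp hornerD hornerX hornerC.
Qed.

Definition bin_poly (j : nat) : {poly rat} :=
  (j`!%:R)^-1 *: \prod_(l <- iota 0 j) ('X - (l%:R)%:P).

Lemma fact_neq0 (j : nat) : j`!%:R != 0 :> rat.
Proof. by rewrite pnatr_eq0 -lt0n fact_gt0. Qed.

Lemma size_bin_poly (j : nat) : size (bin_poly j) = j.+1.
Proof. by rewrite size_scale ?invr_eq0 ?fact_neq0 // size_prod_XsubC size_iota. Qed.

Lemma lead_coef_bin_poly (j : nat) : lead_coef (bin_poly j) = (j`!%:R)^-1.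
Proof.
rewrite lead_coefZ (monicP _) ?mulr1 //; exact: monic_prod_XsubC.
Qed.

Lemma bin_polyE (m j : nat) : (bin_poly j).[m%:R] = 'C(m, j)%:R.
Proof.
rewrite hornerZ; apply: (mulfI (fact_neq0 j)); rewrite mulVKf ?fact_neq0 //.
rewrite -natrM mulnC bin_ffact; elim: j => [|j IH]; first by rewrite big_nil hornerC.
rewrite -addn1 iotaD big_cat /= big_cons big_nil mulr1 hornerM IH hornerXsubC add0n addn1.
rewrite ffactnSr natrM; case: (leqP j m) => [le|lt]; first by rewrite natrB.
by rewrite ffact_small // !mul0r.
Qed.

(** By [bin_detE] and the Vandermonde formula, this is the product of (y_j - y_i) / (j - i) over i <
    j. *)
Definition bin_det (k : nat) (y : nat -> nat) : rat :=
  \det (\matrix_(i < k, j < k) 'C(y i, j)%:R).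

Lemma bin_detE (k : nat) (y : nat -> nat) :
  bin_det k y =
  (\prod_(j < k) j`!%:R)^-1 * \det (\matrix_(i < k, j < k) (y i)%:R ^+ j).
Proof.
rewrite /bin_det -prodfV; under eq_bigr do rewrite -lead_coef_bin_poly.
rewrite -(@det_poly_family k bin_poly (fun i => (y i)%:R) size_bin_poly).
by congr (\det _); apply/matrixP=> i j; rewrite !mxE bin_polyE.
Qed.

Lemma bin_det_shift (k c : nat) (y : nat -> nat) :
  bin_det k (fun i => y i + c)%N = bin_det k y.
Proof.
rewrite !bin_detE; congr (_ * _); rewrite -(@det_pow_shift k c%:R (fun i => (y i)%:R)).
by congr (\det _); apply/matrixP=> i j; rewrite !mxE natrD.
Qed.

(** Subtracting from each row the previous one is multiplication by the unitriangular [U]; the first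
    column becomes (1, 0, ..., 0), and one expands along it. *)
Lemma det_difference (k : nat) (F : nat -> nat -> rat) :
  (forall i, F i 0%N = 1) ->
  \det (\matrix_(i < k, j < k) (F i.+1 j.+1 - F i j.+1)) =
  \det (\matrix_(i < k.+1, j < k.+1) F i j).
Proof.
move=> F0; pose U := \matrix_(i < k.+1, j < k.+1)
  ((i == j :> nat)%:R - (i == j.+1 :> nat)%:R : rat).
have detU : \det U = 1.
  rewrite det_trig; last first.
    by apply/is_trig_mxP=> i j ltij; rewrite !mxE !ltn_eqF ?subrr // ltnS ltnW.
  by apply: big1 => i _; rewrite mxE eqxx ltn_eqF // subr0.
set V := \matrix_(i < k.+1, j < k.+1) F i j.
have UV i j : (U *m V) i j = F i j - (if (0 < i)%N then F i.-1 j else 0).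
  rewrite mxE; under eq_bigr do rewrite !mxE mulrBl.
  rewrite sumrB (bigD1 i) //= eqxx mul1r big1 ?addr0 => [|l]; last first.
    by rewrite -val_eqE eq_sym /= => /negPf ->; rewrite mul0r.
  congr (_ - _); case: ifP => [i_gt0 | /negbT].
    have lt : (i.-1 < k.+1)%N by have := ltn_ord i; lia.
    rewrite (bigD1 (Ordinal lt)) //= prednK // eqxx mul1r big1 ?addr0 // => l.
    rewrite -val_eqE /= => ne; rewrite (_ : (_ == _) = false) ?mul0r //; lia.
  rewrite -leqNgt leqn0 => /eqP ->; rewrite big1 // => l _; by rewrite mul0r.
rewrite -[RHS]mul1r -detU -det_mulmx (expand_det_col _ ord0) big_ord_recl big1 ?addr0 => [|i _].
  rewrite UV /= F0 subr0 mul1r /cofactor /= addn0 expr0 mul1r.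
  by congr (\det _); apply/matrixP=> i j; rewrite mxE [RHS]mxE [RHS]mxE UV !lift0.
by rewrite UV /= !F0 subrr mul0r.
Qed.

Lemma sum_bin (n j lo hi : nat) :
  (lo <= hi <= n)%N ->
  \sum_(v < n | (lo <= v < hi)%N) 'C(v, j)%:R = 'C(hi, j.+1)%:R - 'C(lo, j.+1)%:R :> rat.
Proof.
case/andP=> lelh lehn.
rewrite -(big_mkord (fun v => lo <= v < hi)%N (fun v => 'C(v, j)%:R : rat)).
transitivity (\sum_(lo <= v < hi) ('C(v, j)%:R : rat)).
  rewrite (big_cat_nat (leq0n hi) lehn) //= [X in _ + X]big_nat_cond.
  rewrite [X in _ + X]big_pred0 ?addr0 => [|v]; last lia.
  rewrite (big_cat_nat (leq0n lo) lelh) //= [X in X + _]big_nat_cond.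
  rewrite [X in X + _]big_pred0 ?add0r => [|v]; last lia.
  by rewrite big_nat_cond [RHS]big_nat_cond; apply: eq_bigl => v; lia.
rewrite -(telescope_sumr (fun v => 'C(v, j.+1)%:R)) //.
by apply: eq_bigr => v _; rewrite binS natrD addrAC subrr add0r.
Qed.

(** Binomials are the right basis: summing over an interval raises the lower index by one and leaves
    a difference of consecutive rows. The shift [c] disappears by translation invariance, and
    [c <= 1] keeps the upper ends of the intervals within [n]. *)
Lemma sum_interlace_bin_det (n k c : nat) (B : {set 'I_n}) :
  (c <= 1)%N -> #|B| = k.+1 ->
  \sum_(S | interlace c B S) bin_det k (pos S) = bin_det k.+1 (pos B).
Proof.
move=> lec cardB; rewrite /bin_det (@sum_interlace _ _ _ _ (fun v j => 'C(v, j)%:R)) //.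
rewrite -[RHS]/(bin_det _ _) -(@bin_det_shift _ c) /bin_det.
rewrite -(@det_difference k (fun i j => 'C(pos B i + c, j)%:R)) => [|i]; last by rewrite bin0.
congr (\det _); apply/matrixP=> i j; rewrite !mxE sum_bin //.
have lti1 : (i.+1 < #|B|)%N by rewrite cardB ltnS.
have [x _ ex] := pos_mem lti1; have := pos_lt (ltnSn i) lti1; have := ltn_ord x; lia.
Qed.

(* The number of tilings of a trapezoid of width [k] whose long side has its
   protruding rhombi at [X]. *)
Definition half_count (n k : nat) (X : {set 'I_n}) : rat :=
  (#|X| == k)%:R * bin_det k (pos X).

Lemma sum_interlace_half (n k c : nat) (B : {set 'I_n}) :
  (c <= 1)%N -> \sum_(S | interlace c B S) half_count k S = half_count k.+1 B.
Proof.
move=> lec; rewrite {2}/half_count; have [cardB|neB] := eqVneq.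
  rewrite mul1r -(sum_interlace_bin_det lec cardB).
  apply: eq_bigr => S /interlaceP[]; rewrite cardB => -[eS] _.
  by rewrite /half_count -eS eqxx mul1r.
rewrite mul0r big1 // => S /interlaceP[eB _]; rewrite /half_count.
by move: neB; rewrite eB eqSS => /negPf ->; rewrite mul0r.
Qed.

Lemma walks_left (N M l k : nat) (Z : {set 'I_(N + M)}) :
  (k < N)%N -> (walks (@column_through N M l) set0 k Z)%:R = half_count k Z.
Proof.
elim: k Z => [|k IH] Z ltk /=.
  by rewrite /half_count /bin_det det_mx00 mulr1 eq_sym -cards_eq0.
rewrite natr_sum -(sum_interlace_half k Z (leqnn 1)).
apply: eq_big => [Y|Y _]; last by apply: IH; apply: ltnW.
by rewrite /column_through column_left ?(ltnW ltk) // ltn_eqF // andbT.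
Qed.

Lemma walks_mid (N M l : nat) (Z : {set 'I_(N + M)}) :
  (0 < N)%N ->
  (walks (@column_through N M l) set0 N Z)%:R =
  ([exists j in Z, j == l :> nat])%:R * half_count N Z.
Proof.
case: N Z => // N Z _ /=; rewrite natr_sum -(sum_interlace_half N Z (leqnn 1)).
rewrite big_distrr /= big_mkcond [RHS]big_mkcond /=; apply: eq_bigr => Y _.
rewrite /column_through column_left // eqxx /=.
case: (interlace _ _ _) => //=; case: [exists _ in _, _]; rewrite /= ?mul0r // mul1r.
exact: walks_left.
Qed.

(** The right half is consumed column by column: by [sum_interlace_half] the sum does not change
    when one step passes from the walk to the half count. At [m = N] the half count keeps only the
    empty set. *)
Lemma walks_right (N M l m : nat) :
  (m <= N)%N ->
  \sum_Z (walks (@column_through N M l) set0 (N + m) Z)%:R * half_count (N - m) Z =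
  \sum_Z (walks (@column_through N M l) set0 N Z)%:R * half_count N Z.
Proof.
elim: m => [|m IH] ltm; first by rewrite addn0 subn0.
rewrite -IH ?(ltnW ltm) // addnS /=.
under eq_bigr do rewrite natr_sum big_distrl big_mkcond /=.
rewrite exchange_big /=; apply: eq_bigr => Y _.
rewrite -(subnSK ltm) -(sum_interlace_half _ Y (leq0n 1)) big_distrr /=.
rewrite -big_mkcond; apply: eq_bigl => Z.
by rewrite /column_through column_right ?leq_addr // (_ : (_ == _) = false) ?andbT //; lia.
Qed.

Lemma A_sum_sq (N M : nat) :
  (0 < N)%N ->
  (A N M)%:R = \sum_(X : {set 'I_(N + M)} |
      (#|X| == N) && [exists j in X, j == (N + M)./2 :> nat]) bin_det N (pos X) ^+ 2.
Proof.
move=> N_gt0; rewrite A_walks //.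
transitivity (\sum_Z (walks (@column_through N M (N + M)./2) set0 (N + N) Z)%:R
              * half_count (N - N) Z).
  rewrite subnn (bigD1 set0) //= big1 => [|Z Zn0]; last first.
    by rewrite /half_count cards_eq0 (negPf Zn0) mul0r mulr0.
  by rewrite /half_count cards0 /bin_det det_mx00 !mulr1 addr0 mul2n addnn.
rewrite walks_right // [RHS]big_mkcond; apply: eq_bigr => X _.
rewrite walks_mid // /half_count; case: eqP => _; last by rewrite !mul0r mulr0.
by case: [exists _ in _, _]; rewrite ?mul0r // !mul1r.
Qed.

(** * From sets of heights to sequences of heights *)

Lemma det_ffun_eq0 (n k : nat) (f : {ffun 'I_k -> 'I_n}) (F : nat -> nat -> rat) :
  ~~ injectiveb f -> \det (\matrix_(i < k, j < k) F (f i) j) = 0.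
Proof.
case/injectivePn=> i [j nij eij].
by apply: (determinant_alternate nij) => l; rewrite !mxE eij.
Qed.

(** The squared determinant is symmetric in its rows and vanishes on repetitions, so each set is
    counted once per ordering. Sequences have independent entries, which is what orthogonality
    exploits. *)
Lemma sum_sets_ffun (n k l : nat) (F : nat -> nat -> rat) :
  \sum_(f : {ffun 'I_k -> 'I_n} | [exists i, f i == l :> nat])
     (\det (\matrix_(i < k, j < k) F (f i) j)) ^+ 2 =
  k`!%:R * \sum_(X : {set 'I_n} | (#|X| == k) && [exists j in X, j == l :> nat])
     (\det (\matrix_(i < k, j < k) F (pos X i) j)) ^+ 2.
Proof.
rewrite (bigID (fun f : {ffun 'I_k -> 'I_n} => injectiveb f)) /= addrC big1 ?add0r; last first.
  by move=> f /andP[_ ninj]; rewrite det_ffun_eq0 // expr0n.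
rewrite (partition_big (fun f : {ffun 'I_k -> 'I_n} => f @: setT)
  (fun X : {set 'I_n} => (#|X| == k) && [exists j in X, j == l :> nat])) /=; last first.
  move=> f /andP[/existsP[i fi] /injectiveP inj].
  rewrite card_imset // cardsT card_ord eqxx /=.
  by apply/exists_inP; exists (f i); rewrite ?imset_f.
rewrite big_distrr; apply: eq_bigr => X /andP[/eqP cardX /exists_inP[x Xx xl]] /=.
have -> : k`!%:R =
    #|[set f : {ffun 'I_k -> 'I_n} in ffun_on (mem X) | injectiveb f]|%:R :> rat.
  by rewrite card_inj_ffuns_on cardX card_ord ffactnn.
rewrite -sum1_card natr_sum big_distrl /=.
have E (f : {ffun 'I_k -> 'I_n}) : [exists i, f i == l :> nat] && injectiveb f && (f @: setT == X) =
    (f \in [set f in ffun_on (mem X) | injectiveb f]).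
  rewrite inE; case: injectiveP => inj; rewrite ?andbF // !andbT.
  apply/andP/ffun_onP => [[_ /eqP <-] i|fX]; first exact: imset_f.
  have imX : f @: setT = X.
    apply/eqP; rewrite eqEcard cardX card_imset // cardsT card_ord leqnn andbT.
    by apply/subsetP=> _ /imsetP[i _ ->]; apply: fX.
  split; last exact/eqP.
  by move: Xx; rewrite -imX => /imsetP[i _ xE]; apply/existsP; exists i; rewrite -xE.
apply: eq_big => // f; rewrite E inE => /andP[/ffun_onP fX /injectiveP inj].
rewrite mul1r.
have lt_idx i : (index (f i) (enum X) < k)%N.
  by rewrite (leq_trans _ (eq_leq cardX)) // cardE index_mem mem_enum fX.
pose s i := Ordinal (lt_idx i).
have s_inj : injective s.
  move=> i j /(congr1 val) /= e; apply: inj.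
  by rewrite -(nth_index (f i) (_ : f i \in enum X)) ?e ?nth_index // mem_enum fX.
have -> : \matrix_(i < k, j < k) F (f i) j =
    row_perm (perm s_inj) (\matrix_(i < k, j < k) F (pos X i) j).
  apply/matrixP=> i j; rewrite !mxE permE /pos (nth_map (f i)) /=; last first.
    by rewrite index_mem mem_enum fX.
  by rewrite nth_index // mem_enum fX.
by rewrite row_permE det_mulmx det_perm exprMn sqrr_sign mul1r.
Qed.

(** * Discrete Chebyshev polynomials *)

(** A nonzero determinant forces [f] to be injective, so the sequences that count are split
    according to the unique index [i] with [f i = l]. Expanding both determinants then leaves one
    sum per index, free except at [i]. *)
Lemma sum_det_sq_through (n k : nat) (l : 'I_n) (q : nat -> nat -> rat) (h : nat -> rat) :
  (forall i j : nat, (i < k)%N -> (j < k)%N ->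
     \sum_(v < n) q i v * q j v = (i == j)%:R * h i) ->
  (forall i, (i < k)%N -> h i != 0) ->
  \sum_(f : {ffun 'I_k -> 'I_n} | [exists i, f i == l :> nat])
     (\det (\matrix_(i < k, j < k) q j (f i))) ^+ 2 =
  k`!%:R * (\prod_(j < k) h j * \sum_(j < k) q j l ^+ 2 / h j).
Proof.
move=> orth h_neq0; pose d (f : {ffun 'I_k -> 'I_n}) := \det (\matrix_(i < k, j < k) q j (f i)).
transitivity (\sum_(i < k) \sum_(f : {ffun 'I_k -> 'I_n} | f i == l) d f ^+ 2).
  under [RHS]eq_bigr do rewrite big_mkcond; rewrite exchange_big /= big_mkcond.
  apply: eq_bigr => f _; case: (boolP (injectiveb f)) => [/injectiveP inj|].
    case: existsP => [[i /eqP fi]|none].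
      have eqi : f i = l by apply: val_inj.
      rewrite (bigD1 i) //= eqi eqxx big1 ?addr0 // => j nij.
      by rewrite -eqi (inj_eq inj) (negPf nij).
    by rewrite big1 // => i _; case: eqP => // fi; case: none; exists i; rewrite fi.
  case/injectivePn=> i [j nij eij].
  have d0 : d f = 0 by apply: (determinant_alternate nij) => m; rewrite !mxE eij.
  rewrite -/(d f) d0 expr0n /= if_same big1 // => m _; by rewrite if_same.
(* Orthogonality removes all pairs [s != t]; on the diagonal, each free index gives a norm and the
   index [i] gives the squared value at [l]. *)
have inner (i : 'I_k) : \sum_(f : {ffun 'I_k -> 'I_n} | f i == l) d f ^+ 2 =
    \sum_(s : 'S_k) \prod_(j < k) h j * (q (s i) l ^+ 2 / h (s i)).
  transitivity (\sum_(s : 'S_k) \sum_(t : 'S_k) (-1) ^+ s * (-1) ^+ t *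
     \prod_(m < k) \sum_(v < n | (m == i) ==> (v == l)) q (s m) v * q (t m) v).
    rewrite /d /determinant; under eq_bigr do rewrite expr2 big_distrlr /=.
    rewrite exchange_big; apply: eq_bigr => s _ /=.
    rewrite exchange_big; apply: eq_bigr => t _ /=.
    rewrite bigA_distr_big_dep big_distrr /=; apply: eq_big => f.
      apply/eqP/familyP=> [fi m|/(_ i)]; first by apply/implyP=> /eqP ->; apply/eqP.
      by rewrite unfold_in eqxx => /eqP.
    move=> _; rewrite mulrACA -big_split; congr (_ * _).
    by apply: eq_bigr => m _; rewrite !mxE.
  apply: eq_bigr => s _; rewrite (bigD1 s) //= [X in _ + X]big1 ?addr0.
    rewrite -expr2 sqrr_sign mul1r (bigD1 i) //= eqxx big_pred1_eq -expr2.
    rewrite [in RHS](reindex_inj (@perm_inj _ s)) [in RHS](bigD1 i) //=.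
    under eq_bigr => m mi do rewrite (negPf mi) /= orth // eqxx mul1r.
    by have := h_neq0 _ (ltn_ord (s i)) => hi; field.
  (* Two permutations that agree off [i] also agree at [i], so distinct ones differ at some free
     index, whose factor vanishes. *)
  move=> t nts; have [m mi nm] : exists2 m, m != i & s m != t m.
    apply/exists_inP; apply: contraR nts => /exists_inPn eqst; apply/eqP/permP => m.
    have eq_off j : j != i -> s j = t j by move/eqst; rewrite negbK => /eqP.
    have [->|/eq_off //] := eqVneq m i.
    suff ai : s^-1%g (t i) = i by rewrite -{2}ai permKV.
    have [//|/eq_off ta] := eqVneq (s^-1%g (t i)) i.
    exact: perm_inj (etrans (esym ta) (permKV s (t i))).
  rewrite (bigD1 m) //= (negPf mi) /= orth ?ltn_ord // (_ : (_ == _) = false) ?mul0r ?mulr0 //.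
  by apply/negbTE.
under eq_bigr do rewrite inner.
rewrite exchange_big /=.
transitivity (\sum_(s : 'S_k) \prod_(j < k) h j * \sum_(j < k) q j l ^+ 2 / h j).
  apply: eq_bigr => s _; rewrite -big_distrr /=; congr (_ * _).
  by rewrite [RHS](reindex_inj (@perm_inj _ s)).
by rewrite sumr_const card_Sn mulr_natl.
Qed.

(** The starting polynomial is a parameter so that a whole family can share the roots of [p0], as
    [anti] requires. *)
Fixpoint three_term (c : nat -> rat) (p0 : {poly rat}) (k : nat) : {poly rat} :=
  if k is k1.+1 then
    if k1 is k2.+1 then
      'X * three_term c p0 k1 - (c k1)%:P * three_term c p0 k2
    else 'X * p0
  else p0.

Lemma three_termE (c : nat -> rat) (p0 : {poly rat}) (k : nat) :
  three_term c p0 k.+2 =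
  'X * three_term c p0 k.+1 - (c k.+1)%:P * three_term c p0 k.
Proof. by []. Qed.

Lemma three_term_root (c : nat -> rat) (p0 : {poly rat}) (x : rat) (k : nat) :
  p0.[x] = 0 -> (three_term c p0 k).[x] = 0.
Proof.
move=> p0x; suff [] : (three_term c p0 k).[x] = 0 /\ (three_term c p0 k.+1).[x] = 0 by [].
elim: k => [|k [IH1 IH2]]; first by rewrite /= hornerM p0x mulr0.
by rewrite three_termE hornerD hornerN !hornerM IH1 IH2 !mulr0 subr0.
Qed.

Lemma size_three_term (c : nat -> rat) (k : nat) :
  size (three_term c 1 k) = k.+1 /\ three_term c 1 k \is monic.
Proof.
suff [] : (size (three_term c 1 k) = k.+1 /\ three_term c 1 k \is monic) /\
  (size (three_term c 1 k.+1) = k.+2 /\ three_term c 1 k.+1 \is monic) by [].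
elim: k => [|k [[s1 m1] [s2 m2]]].
  by rewrite /= mulr1 size_polyX size_poly1 monicX monic1.
split=> //; rewrite three_termE.
have sX : size ('X * three_term c 1 k.+1) = k.+3.
  by rewrite mulrC size_mulX ?s2 // monic_neq0.
have lt : (size (- ((c k.+1)%:P * three_term c 1 k))%R < size ('X * three_term c 1 k.+1)%R)%N.
  rewrite size_polyN sX mul_polyC (leq_ltn_trans (size_scale_leq _ _)) // s1 ltnS //.
split; first by rewrite size_polyDl.
by rewrite monicE lead_coefDl // -monicE monicMl ?monicX.
Qed.

(** Recurrence coefficients of the monic discrete Chebyshev polynomials on L points with spacing 1;
    centering at 0 makes the polynomials even or odd and removes the middle term of the recurrence.
    [L] is rational so that identities can be proved with it as an indeterminate. *)
Definition cheb_coef (L : rat) (k : nat) : rat :=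
  k%:R ^+ 2 * (L ^+ 2 - k%:R ^+ 2) / (4 * (4 * k%:R ^+ 2 - 1)).

Definition cheb (L : rat) (k : nat) : {poly rat} := three_term (cheb_coef L) 1 k.

Definition anti_coef (L : rat) (k : nat) : rat :=
  (k.+1%:R ^+ 2 - 1) * (L ^+ 2 - k.+1%:R ^+ 2) / (4 * (4 * k.+1%:R ^+ 2 - 1)).

(* Up to a constant factor, [anti L k] is the discrete antiderivative of
   [cheb L k.+1] which vanishes at both end points [L / 2] and [- L / 2]; it is
   a multiple of a monic Hahn polynomial with parameters (1, 1). *)
Definition anti (L : rat) (k : nat) : {poly rat} :=
  three_term (anti_coef L) ('X ^+ 2 - (L ^+ 2 / 4)%:P) k.

Lemma odd_den_neq0 (k : nat) : 4 * k%:R ^+ 2 - 1 != 0 :> rat.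
Proof.
rewrite subr_eq0 -natrX -natrM -[1]/(1%:R) eqr_nat; case: k => // k.
by rewrite expnS; lia.
Qed.

Lemma horner_three_term (c : nat -> rat) (p0 : {poly rat}) (k : nat) (x : rat) :
  (three_term c p0 k.+2).[x] =
  x * (three_term c p0 k.+1).[x] - c k.+1 * (three_term c p0 k).[x].
Proof. by rewrite three_termE hornerD hornerN !hornerM hornerX hornerC. Qed.

(** The difference of the cases e = 1/2 and e = -1/2 is (k + 2) times [cheb L k.+1] at u, which
    makes [anti] a discrete antiderivative. Both families obey three-term recurrences, so the
    induction carries two consecutive values of k. *)
Lemma anti_half (L u e : rat) (k : nat) :
  e = 1 / 2 \/ e = - (1 / 2) ->
  (anti L k).[u + e] =
  (cheb L k.+2).[u] + k.+2%:R * e * (cheb L k.+1).[u]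
  - (L ^+ 2 - k.+1%:R ^+ 2) * k.+1%:R * k.+2%:R / (4 * (4 * k.+1%:R ^+ 2 - 1))
    * (cheb L k).[u].
Proof.
move=> e2.
suff [] : (anti L k).[u + e] =
  (cheb L k.+2).[u] + k.+2%:R * e * (cheb L k.+1).[u]
  - (L ^+ 2 - k.+1%:R ^+ 2) * k.+1%:R * k.+2%:R / (4 * (4 * k.+1%:R ^+ 2 - 1))
    * (cheb L k).[u] /\ (anti L k.+1).[u + e] =
  (cheb L k.+3).[u] + k.+3%:R * e * (cheb L k.+2).[u]
  - (L ^+ 2 - k.+2%:R ^+ 2) * k.+2%:R * k.+3%:R / (4 * (4 * k.+2%:R ^+ 2 - 1))
    * (cheb L k.+1).[u] by [].
elim: k => [|k [IH1 IH2]].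
  rewrite /cheb !horner_three_term /anti /= -polyC1.
  rewrite !(hornerM, hornerD, hornerN, hornerX, hornerC, horner_exp).
  rewrite /cheb_coef; split.
    by case: e2 => ->; field.
  by case: e2 => ->; field.
split=> //; rewrite /anti horner_three_term -!/(anti _ _) IH1 IH2.
rewrite /cheb !horner_three_term /cheb_coef /anti_coef.
have d1 := odd_den_neq0 k.+1; have d2 := odd_den_neq0 k.+2; have d3 := odd_den_neq0 k.+3.
move: (three_term _ _ k.+1) (three_term _ _ k) => p q.
rewrite -!natr1 in d1 d2 d3 *.
by case: e2 => ->; field; rewrite d1 d2 d3.
Qed.

Definition cheb_at (n k v : nat) : rat := (cheb n%:R k).[v%:R - (n%:R - 1) / 2].

Definition cheb_norm (n k : nat) : rat := n%:R * \prod_(i < k) cheb_coef n%:R i.+1.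

(** Orthogonality to the constants: the sum telescopes to values of [anti] at n / 2 and - n / 2,
    both of which are zero. *)
Lemma sum_cheb_at (n k : nat) : \sum_(v < n) cheb_at n k.+1 v = 0.
Proof.
have k2 : k.+2%:R != 0 :> rat by rewrite pnatr_eq0.
apply: (mulfI k2); rewrite mulr0 big_distrr /=.
pose f (v : nat) := (anti n%:R k).[v%:R - n%:R / 2].
have root_anti (x : rat) : x = n%:R / 2 \/ x = - (n%:R / 2) -> (anti n%:R k).[x] = 0.
  move=> xE; apply: three_term_root.
  by rewrite hornerD hornerN horner_exp hornerX hornerC; case: xE => ->; field.
transitivity (\sum_(v < n) (f v.+1 - f v)).
  apply: eq_bigr => v _; rewrite /f /cheb_at.
  set u := _ - (n%:R - 1) / 2.
  have -> : v.+1%:R - n%:R / 2 = u + 1 / 2 by rewrite /u -natr1; field.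
  have -> : v%:R - n%:R / 2 = u + - (1 / 2) by rewrite /u; field.
  rewrite (@anti_half _ _ (1 / 2)) ?(@anti_half _ _ (- (1 / 2))); try by [left | right].
  by field; rewrite nat1r odd_den_neq0.
transitivity (\sum_(0 <= v < n) (f v.+1 - f v)); first by rewrite big_mkord.
rewrite telescope_sumr // /f.
rewrite (root_anti (n%:R - _)) ?(root_anti (0%:R - _)) ?subrr //.
  by right; rewrite sub0r.
by left; field.
Qed.

(** At [k = 0] the truncated [k.-1] does no harm, since its coefficient is zero. *)
Lemma cheb_atX (n k v : nat) :
  (v%:R - (n%:R - 1) / 2) * cheb_at n k v =
  cheb_at n k.+1 v + cheb_coef n%:R k * cheb_at n k.-1 v.
Proof.
rewrite /cheb_at; case: k => [|k].
  by rewrite /cheb /= hornerM hornerX /cheb_coef expr0n /= !mul0r addr0.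
by rewrite /cheb horner_three_term /= subrK.
Qed.

Definition cheb_dot (n i j : nat) : rat := \sum_(v < n) cheb_at n i v * cheb_at n j v.

Lemma cheb_dotC (n i j : nat) : cheb_dot n i j = cheb_dot n j i.
Proof. by apply: eq_bigr => v _; rewrite mulrC. Qed.

(** Multiplication by the abscissa is self-adjoint, so the recurrence can be moved from one factor
    to the other. *)
Lemma cheb_dot_rec (n i j : nat) :
  cheb_dot n i.+1 j = cheb_dot n i j.+1 + cheb_coef n%:R j * cheb_dot n i j.-1
                      - cheb_coef n%:R i * cheb_dot n i.-1 j.
Proof.
rewrite /cheb_dot !big_distrr -big_split -sumrB /=; apply: eq_bigr => v _.
have := cheb_atX n i v; have := cheb_atX n j v.
set u := _ - _ / 2 => ej ei.
have -> : cheb_at n i.+1 v = u * cheb_at n i v - cheb_coef n%:R i * cheb_at n i.-1 v.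
  by rewrite ei addrK.
have -> : cheb_at n j.+1 v = u * cheb_at n j v - cheb_coef n%:R j * cheb_at n j.-1 v.
  by rewrite ej addrK.
ring.
Qed.

(** Every product on the right of [cheb_dot_rec] has a smaller first index, still below the second
    one; the induction ends at orthogonality to the constants. *)
Lemma cheb_dot0 (n i j : nat) : (i < j)%N -> cheb_dot n i j = 0.
Proof.
elim/ltn_ind: i j => -[_ [//|j] _|i IH [//|j] ltij].
  rewrite /cheb_dot -[RHS](sum_cheb_at n j); apply: eq_bigr => v _.
  by rewrite /cheb_at /cheb /= hornerE mul1r.
rewrite cheb_dot_rec !IH //; try lia.
by rewrite !mulr0 addr0 subr0.
Qed.

Lemma cheb_dot_norm (n i : nat) : cheb_dot n i i = cheb_norm n i.
Proof.
elim: i => [|i IH].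
  rewrite /cheb_norm big_ord0 mulr1 /cheb_dot.
  under eq_bigr do rewrite /cheb_at /cheb /= hornerE mulr1.
  by rewrite sumr_const card_ord.
rewrite cheb_dot_rec /= IH [cheb_dot n i i.+2]cheb_dot0 // add0r.
have -> : cheb_coef n%:R i * cheb_dot n i.-1 i.+1 = 0.
  case: i {IH} => [|i] /=; last by rewrite cheb_dot0 ?mulr0 //; lia.
  by rewrite /cheb_coef expr0n /= !mul0r.
by rewrite subr0 /cheb_norm big_ord_recr /=; ring.
Qed.

Lemma cheb_orthogonal (n i j : nat) :
  \sum_(v < n) cheb_at n i v * cheb_at n j v = (i == j)%:R * cheb_norm n i.
Proof.
rewrite -/(cheb_dot n i j).
case: (ltngtP i j) => [lt|lt|->]; last by rewrite mul1r cheb_dot_norm.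
  by rewrite cheb_dot0 // mul0r.
by rewrite cheb_dotC cheb_dot0 // mul0r.
Qed.

Lemma cheb_coef_gt0 (n k : nat) : (0 < k < n)%N -> 0 < cheb_coef n%:R k.
Proof.
case/andP=> k_gt0 ltkn; rewrite /cheb_coef.
have k1 : (1 : rat) <= k%:R by rewrite ler1n.
have kn : (k%:R : rat) < n%:R by rewrite ltr_nat.
apply: divr_gt0; [apply: mulr_gt0 |]; nra.
Qed.

Lemma cheb_norm_gt0 (n k : nat) : (k < n)%N -> 0 < cheb_norm n k.
Proof.
move=> ltkn; apply: mulr_gt0; first by rewrite ltr0n; apply: leq_ltn_trans ltkn.
apply: prodr_gt0 => i _; apply: cheb_coef_gt0 => /=.
exact: leq_ltn_trans (ltn_ord i) ltkn.
Qed.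

Lemma factSr (m : nat) : m.+1`!%:R = (m%:R + 1) * m`!%:R :> rat.
Proof. by rewrite factS natrM natr1. Qed.

Lemma cheb_normE (n k : nat) :
  (k < n)%N ->
  cheb_norm n k =
  k`!%:R ^+ 4 * (n + k)`!%:R / ((2 * k)`!%:R * (2 * k).+1`!%:R * (n - k).-1`!%:R).
Proof.
elim: k => [|k IH] ltkn.
  case: n ltkn => // n _; rewrite /cheb_norm big_ord0 addn0 subn0 muln0 /=.
  rewrite (_ : 0`! = 1%N) // (_ : 1`! = 1%N) // factS natrM.
  by field; rewrite fact_neq0.
rewrite /cheb_norm big_ord_recr mulrA -/(cheb_norm n k) IH ?(ltnW ltkn) // {IH}.
have [m en] : exists m, n = (k + m.+2)%N by exists (n - k.+2)%N; lia.
have -> : (n - k).-1 = m.+1 by lia.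
have -> : (n - k.+1).-1 = m by lia.
have -> : (2 * k.+1)%N = (2 * k).+2 by lia.
have nE : n%:R = k%:R + m%:R + 2 :> rat by rewrite en -addn2 addnA !natrD.
rewrite addnS /cheb_coef /= (factSr (n + k)) (factSr k) (factSr (2 * k).+2) (factSr (2 * k).+1).
rewrite (factSr (2 * k)) (factSr m).
have := fact_neq0 (n + k); have := fact_neq0 k; have := fact_neq0 m; have := fact_neq0 (2 * k).
rewrite -!(natr1 (2 * k)) -(natr1 (2 * k).+1) -(natr1 (2 * k)) -(natr1 k) natrD natrM nE.
move: (k`!%:R) (m`!%:R) ((2 * k)`!%:R) ((n + k)`!%:R) => a b c d c0 b0 a0 d0.
have := ler0n rat k; have := ler0n rat m.
move: (k%:R : rat) (m%:R : rat) => x y y0 x0.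
field; rewrite b0 c0 /=.
by do ![apply/andP; split]; apply: lt0r_neq0; nra.
Qed.

(* The middle point [n / 2] has abscissa [1 / 2] once the [n] points are
   centered at [0]. *)
Definition center_density (n N : nat) : rat :=
  \sum_(k < N) (cheb n%:R k).[1 / 2] ^+ 2 / cheb_norm n k.

Lemma bin_det_cheb (n k : nat) (y : nat -> nat) :
  bin_det k y =
  (\prod_(j < k) j`!%:R)^-1 * \det (\matrix_(i < k, j < k) cheb_at n j (y i)).
Proof.
rewrite bin_detE; congr (_ * _).
have size_cheb j : size (cheb n%:R j) = j.+1 by have [] := size_three_term (cheb_coef n%:R) j.
rewrite -(@det_pow_shift k (- ((n%:R - 1) / 2)) (fun i => (y i)%:R)).
rewrite (@det_poly_family k _ (fun i => (y i)%:R - (n%:R - 1) / 2) size_cheb).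
rewrite big1 ?mul1r // => j _; apply/monicP.
by have [] := size_three_term (cheb_coef n%:R) j.
Qed.

Lemma A_center_density (N M : nat) :
  (0 < N)%N -> ~~ odd (N + M) ->
  (A N M)%:R =
  (\prod_(j < N) j`!%:R)^-1 ^+ 2 * \prod_(k < N) cheb_norm (N + M) k
  * center_density (N + M) N.
Proof.
move=> N_gt0 even_n; set n := (N + M)%N; set l := (n./2)%N.
have nE : n = l.*2 by rewrite -[LHS]odd_double_half (negPf even_n).
have ltl : (l < n)%N by rewrite /l; lia.
rewrite A_sum_sq //; under eq_bigr do rewrite (bin_det_cheb n) exprMn.
rewrite -big_distrr -mulrA; congr (_ * _) => /=.
apply: (mulfI (fact_neq0 N)).
rewrite -(@sum_sets_ffun n N l (fun v j => cheb_at n j v)).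
rewrite (@sum_det_sq_through n N (Ordinal ltl) (cheb_at n) (cheb_norm n)) /=; first last.
- by move=> i lti; apply/lt0r_neq0/cheb_norm_gt0; rewrite /n; lia.
- by move=> i j _ _; apply: cheb_orthogonal.
congr (_ * (_ * _)); apply: eq_bigr => k _; rewrite /cheb_at.
congr (_.[_] ^+ 2 / _); rewrite [in n%:R]nE -muln2 natrM.
by field.
Qed.

(** * The product T as the normalizing constant *)

Lemma prod_fact_double (N : nat) :
  (\prod_(k < N) (k`! * (N + k)`!) = \prod_(k < N) ((2 * k)`! * (2 * k).+1`!))%N.
Proof.
elim: N => [|N IH]; first by rewrite !big_ord0.
have -> : (\prod_(k < N.+1) (k`! * (N.+1 + k)`!) =
    \prod_(k < N) k`! * N`! * (\prod_(k < N) (N + k.+1)`! * (2 * N).+1`!))%N.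
  rewrite big_split big_ord_recr; congr (_ * _)%N; rewrite big_ord_recr.
  congr (_ * _)%N; last by congr (_`!); rewrite mul2n -addnn.
  by apply: eq_bigr => k _; congr (_`!); rewrite addnS.
rewrite [RHS]big_ord_recr /= -IH big_split /=.
have : (\prod_(k < N) (N + k.+1)`! * N`! = \prod_(k < N) (N + k)`! * (2 * N)`!)%N.
  rewrite mul2n -addnn; transitivity (\prod_(k < N.+1) (N + k)`!)%N.
    by rewrite big_ord_recl addn0 mulnC.
  by rewrite big_ord_recr.
move: (\prod_(k < N) (N + k.+1)`!)%N (\prod_(k < N) (N + k)`!)%N => p q.
move: (\prod_(k < N) k`!)%N ((2 * N)`!) ((2 * N).+1`!) (N`!) => r s t u e.
rewrite (_ : _ * _ * _ = r * t * (p * u))%N; last ring.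
by rewrite e; ring.
Qed.

Lemma prod_shift (b N : nat) :
  (0 < b)%N ->
  \prod_(1 <= k < N.+1) (((b.+1 + k)%:R - 1) / ((b.+1 + k)%:R - 2)) =
  (b + N)%:R / b%:R :> rat.
Proof.
move=> b_gt0; have b0 : b%:R != 0 :> rat by rewrite pnatr_eq0 -lt0n.
elim: N => [|N IH]; first by rewrite big_geq // addn0 divff.
rewrite big_nat_recr //= IH !addSn addnS -!natr1.
have bN : (b + N)%:R != 0 :> rat by rewrite pnatr_eq0 addn_eq0 negb_and -lt0n b_gt0.
rewrite (_ : _ - 2 = (b + N)%:R); last ring.
by field; rewrite b0 -natrD bN.
Qed.

Lemma T_step (N M : nat) :
  T N M.+1 = T N M * \prod_(k < N) ((N + M + k.+1)%:R / (N + M - k)%:R).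
Proof.
rewrite /T; transitivity (\prod_(1 <= i < N.+1) ((\prod_(1 <= j < M.+1) \prod_(1 <= k < N.+1)
    (((i + j + k)%:R - 1) / ((i + j + k)%:R - 2))) * ((i + M + N)%:R / (i + M)%:R)) : rat).
  apply: eq_big_nat => i /andP[i_gt0 _]; rewrite big_nat_recr //= addnS prod_shift //.
  by rewrite addn_gt0 i_gt0.
rewrite big_split; congr (_ * _) => /=.
rewrite big_add1 /= big_mkord !prodf_div; congr (_ / _).
  by apply: eq_bigr => i _; congr (_%:R); lia.
(* The denominators are paired with the numerators in reverse order, so that each factor becomes a
   ratio of norms in [T_norm]. *)
rewrite (reindex_inj rev_ord_inj) /=; apply: eq_bigr => i _; congr (_%:R).
by have := ltn_ord i; lia.
Qed.

(** By [cheb_normE], one more point multiplies the norm of degree k by (n + k + 1) / (n - k), which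
    is the k-th factor of [T_step]. At M = 0 the product T is empty and the claim reduces to
    [prod_fact_double]. *)
Lemma T_norm (N M : nat) :
  T N M = (\prod_(j < N) j`!%:R)^-1 ^+ 2 * \prod_(k < N) cheb_norm (N + M) k.
Proof.
elim: M => [|M IH].
  rewrite /T big1 => [|i _]; last by rewrite big_geq.
  rewrite addn0.
  rewrite [X in _ * X](eq_bigr _ (fun k _ => cheb_normE (ltn_ord k))).
  have P0 : \prod_(j < N) j`!%:R != 0 :> rat by apply/prodf_neq0 => j _; apply: fact_neq0.
  have := congr1 (fun m => m%:R : rat) (prod_fact_double N).
  rewrite !natr_prod; under eq_bigr do rewrite natrM.
  under [in RHS]eq_bigr do rewrite natrM.
  rewrite !big_split /= => E.
  rewrite prodfV !big_split /= -E.
  have -> : \prod_(k < N) (N - k).-1`!%:R = \prod_(k < N) k`!%:R :> rat.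
    rewrite [RHS](reindex_inj rev_ord_inj); apply: eq_bigr => k _ /=.
    by rewrite -subnS.
  have P1 : \prod_(j < N) (N + j)`!%:R != 0 :> rat by apply/prodf_neq0 => j _; apply: fact_neq0.
  by field; rewrite P0 P1.
rewrite T_step IH -mulrA -big_split; congr (_ * _); apply: eq_bigr => k _ /=.
rewrite !cheb_normE; [|have := ltn_ord k; lia..].
have ltk := ltn_ord k.
have -> : (N + M.+1 + k)%N = (N + M + k).+1 by lia.
have [m em] : exists m, (N + M - k = m.+1)%N by exists (N + M - k).-1; lia.
have -> : (N + M.+1 - k).-1 = m.+1 by lia.
rewrite addnS em /= !factSr -!natr1.
have := fact_neq0 (2 * k).+1; have := fact_neq0 (2 * k); have := fact_neq0 m.
rewrite factSr => h1 h2 h3.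
have m1 : (m%:R + 1 : rat) != 0 by rewrite natr1 pnatr_eq0.
have k1 : (2 * k%:R + 1 : rat) != 0 by rewrite -natrM natr1 pnatr_eq0.
by field; rewrite h1 m1 h2 k1.
Qed.

Lemma A_eq_T (N M : nat) :
  (0 < N)%N -> ~~ odd (N + M) -> (A N M)%:R = center_density (N + M) N * T N M.
Proof. by move=> N_gt0 ev; rewrite A_center_density // T_norm mulrC. Qed.

(** There are no triangles when N = 0, so the axis rhombus is the empty set, which no partition
    contains. This settles (c) at n = 0. *)
Lemma A0 (M : nat) : A 0 M = 0%N.
Proof.
apply: eq_card0 => P; rewrite inE; apply/negP=> /andP[/andP[/and3P[_ _ /negP n0] _] Pa].
by apply: n0; move: Pa; congr (_ \in P); apply/setP=> -[[[]]].
Qed.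

(** * The density next to the center *)

(** At the abscissa 1/2 each step of the recurrence collapses to a rational factor, and the factor
    of the odd step does not depend on [L]. *)
Lemma cheb_center (L : rat) (j : nat) :
  (cheb L (2 * j).+1).[1 / 2] =
    (2 * j%:R + 1) ^+ 2 / (2 * (4 * j%:R + 1)) * (cheb L (2 * j)).[1 / 2] /\
  (cheb L (2 * j).+2).[1 / 2] =
    (2 * j%:R + 1) ^+ 2 * ((2 * j%:R + 2) ^+ 2 - L ^+ 2)
    / (4 * (4 * j%:R + 1) * (4 * j%:R + 3)) * (cheb L (2 * j)).[1 / 2].
Proof.
suff E1 : (cheb L (2 * j).+1).[1 / 2] =
    (2 * j%:R + 1) ^+ 2 / (2 * (4 * j%:R + 1)) * (cheb L (2 * j)).[1 / 2].
  split=> //; rewrite /cheb horner_three_term -!/(cheb _ _) E1 /cheb_coef.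
  rewrite -!natr1 natrM; have := ler0n rat j; move: (j%:R : rat) => x x0.
  by field; do ![apply/andP; split]; apply: lt0r_neq0; nra.
elim: j => [|j IH].
  by rewrite muln0 /cheb /= -polyC1 hornerM hornerX hornerC; field.
rewrite mulnS add2n /cheb horner_three_term -!/(cheb _ _).
rewrite [(cheb L (2 * j).+2).[_]]horner_three_term -!/(cheb _ _) IH /cheb_coef.
rewrite -!natr1 natrM; have := ler0n rat j; move: (j%:R : rat) => x x0.
by field; do ![apply/andP; split]; apply: lt0r_neq0; nra.
Qed.

(** The number of points is written 2 (j + d + 1) to avoid truncated subtraction. In the induction,
    [j] grows while [d] decreases, at a fixed number of points. *)
Lemma cheb_center_even (j d : nat) :
  (cheb (2 * (j + d).+1)%:R (2 * j)).[1 / 2] =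
  (-1) ^+ j * (2 * j + d).+1`!%:R * (2 * j)`!%:R ^+ 3
  / ((j + d).+1%:R * d`!%:R * j`!%:R ^+ 2 * (4 * j)`!%:R).
Proof.
elim: j d => [|j IH] d.
  rewrite !muln0 !add0n /cheb /= -polyC1 hornerC (_ : 0`! = 1%N) // factSr -natr1.
  have := fact_neq0 d; have : d%:R + 1 != 0 :> rat by rewrite natr1 pnatr_eq0.
  by move=> h1 h2; field; rewrite h2 addrC h1.
have -> : (2 * j.+1)%N = (2 * j).+2 by lia.
have [_ ->] := cheb_center (2 * (j.+1 + d).+1)%:R j.
rewrite addSnnS IH.
have -> : ((2 * j).+2 + d).+1 = (2 * j + d.+1).+2 by lia.
have -> : (4 * j.+1)%N = (4 * j).+4 by lia.
rewrite (factSr (2 * j + d.+1).+1) (factSr (2 * j).+1) (factSr (2 * j)) (factSr d) (factSr j).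
rewrite (factSr (4 * j).+3) (factSr (4 * j).+2) (factSr (4 * j).+1) (factSr (4 * j)) (exprS (-1)).
have := fact_neq0 (4 * j); have := fact_neq0 j; have := fact_neq0 d.
have := ler0n rat j; have := ler0n rat d => y0 x0 a0 b0 c0.
field; rewrite a0 b0 c0 /=.
by do ![apply/andP; split]; apply: lt0r_neq0; lra.
Qed.

(* The term of degree [2 * j] of the density for [n = 2 * (j + d + 1)]. *)
Definition even_term (j d : nat) : rat :=
  (2 * j + d).+1`!%:R ^+ 2 * (2 * j)`!%:R ^+ 2 * (4 * j).+1%:R * (2 * d).+1`!%:R
  / ((j + d).+1%:R ^+ 2 * d`!%:R ^+ 2 * j`!%:R ^+ 4 * (4 * j + 2 * d).+2`!%:R).

Lemma even_termE (j d : nat) :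
  (cheb (2 * (j + d).+1)%:R (2 * j)).[1 / 2] ^+ 2
  / cheb_norm (2 * (j + d).+1) (2 * j) = even_term j d.
Proof.
rewrite cheb_center_even cheb_normE; last lia.
have -> : (2 * (j + d).+1 + 2 * j = (4 * j + 2 * d).+2)%N by lia.
have -> : ((2 * (j + d).+1 - 2 * j).-1 = (2 * d).+1)%N by lia.
have -> : (2 * (2 * j) = 4 * j)%N by lia.
rewrite /even_term (factSr (4 * j)) !expr_div_n !exprMn sqrr_sign.
have := fact_neq0 (4 * j + 2 * d).+2; have := fact_neq0 (2 * d).+1; have := fact_neq0 (2 * j).
have := fact_neq0 (4 * j); have := fact_neq0 j; have := fact_neq0 d => a0 b0 c0 d0 e0 f0.
have := ler0n rat j; have := ler0n rat d => y0 x0.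
by field; do ?[apply/andP; split] => //; apply: lt0r_neq0; lra.
Qed.

(** [L] is the number of points before two are added; the degree stays 2j. *)
Lemma even_termSr (j d : nat) (L : rat) :
  L = 2 * (j%:R + d%:R + 1) ->
  even_term j d.+1 = even_term j d *
    (L ^+ 2 * (L + 2 * j%:R + 2) * (L + 1 - 2 * j%:R)
     / ((L + 2) ^+ 2 * (L - 2 * j%:R) * (L + 2 * j%:R + 1))).
Proof.
move=> ->; rewrite /even_term.
have -> : (2 * j + d.+1).+1 = (2 * j + d).+2 by lia.
have -> : (2 * d.+1).+1 = (2 * d).+3 by lia.
have -> : (4 * j + 2 * d.+1).+2 = (4 * j + 2 * d).+4 by lia.
rewrite (factSr (4 * j + 2 * d).+3) (factSr (4 * j + 2 * d).+2) (factSr (2 * j + d).+1).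
rewrite (factSr (2 * d).+2) (factSr (2 * d).+1) (factSr d).
have := fact_neq0 (4 * j + 2 * d).+2; have := fact_neq0 j; have := fact_neq0 d => a0 b0 c0.
have := ler0n rat j; have := ler0n rat d => y0 x0.
by field; do ?[apply/andP; split] => //; apply: lt0r_neq0; lra.
Qed.

(** Both terms have the same number [L] of points: the degree rises by two at the expense of [d]. *)
Lemma even_termSl (j d : nat) (L : rat) :
  L = 2 * (j%:R + d%:R + 2) ->
  even_term j.+1 d = even_term j d.+1 *
    ((2 * j%:R + 1) ^+ 2 * (4 * j%:R + 5)
     * ((L - (2 * j%:R + 2)) * (L + (2 * j%:R + 2)))
     / ((4 * j%:R + 1) * ((L - (2 * j%:R + 1)) * (L + (2 * j%:R + 1)))
        * (2 * j%:R + 2) ^+ 2)).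
Proof.
move=> ->; rewrite /even_term.
have -> : (2 * j.+1 + d).+1 = (2 * j + d).+3 by lia.
have -> : (2 * j + d.+1).+1 = (2 * j + d).+2 by lia.
have -> : (2 * d.+1).+1 = (2 * d).+3 by lia.
have -> : (4 * j.+1 + 2 * d).+2 = (4 * j + 2 * d).+4.+2 by lia.
have -> : (4 * j + 2 * d.+1).+2 = (4 * j + 2 * d).+4 by lia.
have -> : (2 * j.+1 = (2 * j).+2)%N by lia.
rewrite (factSr (4 * j + 2 * d).+1.+4) (factSr (4 * j + 2 * d).+4) (factSr (2 * j + d).+2).
rewrite (factSr (2 * d).+2) (factSr (2 * d).+1) (factSr d) (factSr j).
rewrite (factSr (2 * j).+1) (factSr (2 * j)).
have := fact_neq0 (4 * j + 2 * d).+4; have := fact_neq0 j; have := fact_neq0 d => a0 b0 c0.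
have := ler0n rat j; have := ler0n rat d => y0 x0.
by field; do ?[apply/andP; split] => //; apply: lt0r_neq0; lra.
Qed.

Lemma center_density_even (j d : nat) :
  center_density (2 * (j + d).+1) (2 * j).+1 =
  center_density (2 * (j + d).+1) (2 * j) + even_term j d.
Proof. by rewrite -even_termE /center_density big_ord_recr. Qed.

(** The second summand in the bracket is the term of degree 2j + 1 relative to that of degree 2j:
    the squared ratio from [cheb_center] divided by the ratio of norms [cheb_coef]. *)
Lemma center_density_odd (j d : nat) (L : rat) :
  L = 2 * (j%:R + d%:R + 1) ->
  center_density (2 * (j + d).+1) (2 * j).+2 =
  center_density (2 * (j + d).+1) (2 * j) + even_term j d *
    (1 + (2 * j%:R + 1) ^+ 2 * (4 * j%:R + 3)
         / ((4 * j%:R + 1) * ((L - (2 * j%:R + 1)) * (L + (2 * j%:R + 1))))).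
Proof.
move=> LE; rewrite /center_density big_ord_recr -!/(center_density _ _) /=.
rewrite center_density_even -addrA; congr (_ + _).
have -> : cheb_norm (2 * (j + d).+1) (2 * j).+1 =
    cheb_norm (2 * (j + d).+1) (2 * j) * cheb_coef (2 * (j + d).+1)%:R (2 * j).+1.
  by rewrite /cheb_norm big_ord_recr /= mulrA.
have [-> _] := cheb_center (2 * (j + d).+1)%:R j.
rewrite -even_termE LE /cheb_coef.
have h0 : cheb_norm (2 * (j + d).+1) (2 * j) != 0.
  by apply/lt0r_neq0/cheb_norm_gt0; lia.
have := ler0n rat j; have := ler0n rat d => y0 x0.
by field; do ?[apply/andP; split] => //; apply: lt0r_neq0; nra.
Qed.

(* The subtracted term is the WZ mate of the summand of [center_density_odd],
   hence the induction on [j]. *)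
Lemma center_density_telescope (j d : nat) (L : rat) :
  L = 2 * (j%:R + d%:R + 1) ->
  center_density (2 * (j + d).+2) (2 * j) =
  center_density (2 * (j + d).+1) (2 * j) - even_term j d *
    (8 * j%:R ^+ 2 * (L + 1) * (L ^+ 2 + 2 * L + 4 * j%:R + 2)
     / ((L + 2) ^+ 2 * (L - 2 * j%:R) * (L + 2 * j%:R + 1) * (4 * j%:R + 1))).
Proof.
elim: j d L => [|j IH] d L LE.
  by rewrite /center_density !big_ord0 expr0n /= !(mulr0, mul0r) subr0.
have -> : (2 * j.+1 = (2 * j).+2)%N by lia.
have -> : ((j.+1 + d).+2 = (j + d.+2).+1)%N by lia.
have -> : ((j.+1 + d).+1 = (j + d.+1).+1)%N by lia.
rewrite (@center_density_odd j d.+2 (L + 2)); last by rewrite LE; ring.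
rewrite (@center_density_odd j d.+1 L); last by rewrite LE; ring.
have -> : ((j + d.+2).+1 = (j + d.+1).+2)%N by lia.
rewrite (IH d.+1 L); last by rewrite LE; ring.
rewrite (@even_termSr j d.+1 L); last by rewrite LE; ring.
rewrite (@even_termSl j d L); last by rewrite LE; ring.
(* All terms are now multiples of [even_term j d.+1], so that a rational identity in j and d
   remains: the WZ equation. *)
rewrite LE; move: (even_term j d.+1) (center_density _ _) => E S.
have := ler0n rat j; have := ler0n rat d => y0 x0.
by field; do ?[apply/andP; split] => //; apply: lt0r_neq0; lra.
Qed.

(** * Closed forms near the diagonal N = M *)

Lemma central_binE (k : nat) : 'C(2 * k, k)%:R = (2 * k)`!%:R / k`!%:R ^+ 2 :> rat.
Proof.
have := fact_neq0 k => k0; apply: (canRL (mulfK _)); first by rewrite expf_neq0.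
by rewrite expr2 -!natrM -(@bin_fact (2 * k) k) ?mul2n ?leq_addr -?addnn ?leq_addl // addnK.
Qed.

Lemma central_binS (k : nat) :
  'C(2 * k.+1, k.+1)%:R = 'C(2 * k, k)%:R * (2 * (2 * k%:R + 1) / (k%:R + 1)) :> rat.
Proof.
rewrite !central_binE; have -> : (2 * k.+1 = (2 * k).+2)%N by lia.
rewrite (factSr (2 * k).+1) (factSr (2 * k)) (factSr k).
have := fact_neq0 k; have := ler0n rat k => x0 a0.
by field; do ?[apply/andP; split] => //; apply: lt0r_neq0; lra.
Qed.

Definition cubic_ratio (n : nat) : rat := 'C(2 * n, n)%:R ^+ 3 / 'C(6 * n, 3 * n)%:R.

Lemma cubic_ratio1 (n : nat) :
  'C(2 * n, n)%:R ^+ 3 / 'C(6 * n + 2, 3 * n + 1)%:R =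
  cubic_ratio n * ((3 * n%:R + 1) / (2 * (6 * n%:R + 1))).
Proof.
have -> : (6 * n + 2 = 2 * (3 * n).+1)%N by lia.
rewrite addn1 central_binS /cubic_ratio (_ : (6 * n = 2 * (3 * n))%N); last lia.
have c0 : 'C(2 * (3 * n), 3 * n)%:R != 0 :> rat.
  by rewrite pnatr_eq0 -lt0n bin_gt0; lia.
have x0 := ler0n rat n.
by field; do ?[apply/andP; split] => //; apply: lt0r_neq0; lra.
Qed.

Lemma cubic_ratio2 (n : nat) :
  'C(2 * n, n)%:R ^+ 3 / 'C(6 * n + 4, 3 * n + 2)%:R =
  cubic_ratio n * ((3 * n%:R + 1) * (3 * n%:R + 2)
                   / (4 * (6 * n%:R + 1) * (6 * n%:R + 3))).
Proof.
have -> : (6 * n + 4 = 2 * (3 * n).+2)%N by lia.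
rewrite addn2 !central_binS /cubic_ratio (_ : (6 * n = 2 * (3 * n))%N); last lia.
have c0 : 'C(2 * (3 * n), 3 * n)%:R != 0 :> rat.
  by rewrite pnatr_eq0 -lt0n bin_gt0; lia.
have x0 := ler0n rat n.
by field; do ?[apply/andP; split] => //; apply: lt0r_neq0; lra.
Qed.

Lemma cubic_ratioS (n : nat) :
  cubic_ratio n.+1 = cubic_ratio n *
    ((2 * n%:R + 1) ^+ 3 * (3 * n%:R + 1) * (3 * n%:R + 2) * (3 * n%:R + 3)
     / ((n%:R + 1) ^+ 3 * (6 * n%:R + 1) * (6 * n%:R + 3) * (6 * n%:R + 5))).
Proof.
rewrite /cubic_ratio (_ : (3 * n.+1 = (3 * n).+3)%N); last lia.
rewrite (_ : (6 * n.+1 = 2 * (3 * n).+3)%N); last lia.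
rewrite (_ : (6 * n = 2 * (3 * n))%N); last lia.
rewrite !central_binS.
have c0 : 'C(2 * (3 * n), 3 * n)%:R != 0 :> rat.
  by rewrite pnatr_eq0 -lt0n bin_gt0; lia.
have x0 := ler0n rat n.
by field; do ?[apply/andP; split] => //; apply: lt0r_neq0; lra.
Qed.

(** On the diagonal the factorials regroup into central binomials: this is where the cube over a
    single binomial comes from. *)
Lemma even_term_diag (n : nat) :
  even_term n n = cubic_ratio n *
    ((3 * n%:R + 1) * (4 * n%:R + 1) / (2 * (2 * n%:R + 1) * (6 * n%:R + 1))).
Proof.
rewrite /even_term /cubic_ratio (_ : (6 * n = 2 * (3 * n))%N); last lia.
rewrite !central_binE.
have -> : (2 * n + n).+1 = (3 * n).+1 by lia.
have -> : (4 * n + 2 * n).+2 = (2 * (3 * n)).+2 by lia.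
rewrite (factSr (3 * n)) (factSr (2 * (3 * n)).+1) (factSr (2 * (3 * n))) (factSr (2 * n)).
have := fact_neq0 n; have := fact_neq0 (2 * n); have := fact_neq0 (3 * n).
have := fact_neq0 (2 * (3 * n)) => d0 c0 b0 a0.
have x0 := ler0n rat n.
by field; do ?[apply/andP; split] => //; apply: lt0r_neq0; lra.
Qed.

Lemma even_term_subdiag (p : nat) :
  even_term p.+1 p = cubic_ratio p.+1 * ((4 * p%:R + 5) / (8 * (p%:R + 1))).
Proof.
rewrite /even_term /cubic_ratio (_ : (6 * p.+1 = 2 * (3 * p.+1))%N); last lia.
rewrite !central_binE.
have -> : (2 * p.+1 + p).+1 = (3 * p.+1)%N by lia.
have -> : (4 * p.+1 + 2 * p).+2 = (2 * (3 * p.+1))%N by lia.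
have -> : (2 * p.+1 = (2 * p).+2)%N by lia.
rewrite (factSr (2 * p).+1) (factSr p).
have := fact_neq0 p; have := fact_neq0 (2 * p).+1; have := fact_neq0 (3 * p.+1).
have := fact_neq0 (2 * (3 * p.+1)) => d0 c0 b0 a0.
have x0 := ler0n rat p.
by field; do ?[apply/andP; split] => //; apply: lt0r_neq0; lra.
Qed.

Lemma density_b (n : nat) :
  center_density (2 * (n + n).+1) (2 * n).+1 =
  center_density (2 * (n + n).+1) (2 * n) + cubic_ratio n *
    ((3 * n%:R + 1) * (4 * n%:R + 1) / (2 * (2 * n%:R + 1) * (6 * n%:R + 1))).
Proof. by rewrite center_density_even even_term_diag. Qed.

Lemma density_e (n : nat) :
  center_density (2 * (n + n).+1) (2 * n).+2 =
  center_density (2 * (n + n).+1) (2 * n) + cubic_ratio n *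
    ((3 * n%:R + 1) * (4 * n%:R + 1) / (2 * (2 * n%:R + 1) * (6 * n%:R + 1))
     * (1 + (4 * n%:R + 3) / (3 * (4 * n%:R + 1)))).
Proof.
rewrite (@center_density_odd n n (4 * n%:R + 2)); last ring.
rewrite even_term_diag; move: (cubic_ratio _) (center_density _ _) => c s.
have x0 := ler0n rat n.
by field; do ?[apply/andP; split] => //; apply: lt0r_neq0; lra.
Qed.

(** One step of the staircase, from (c) at p to (a) at p + 1: [density_e] adds two terms, then
    [center_density_telescope] adds two points. *)
Lemma density_a_rec (p : nat) :
  center_density (2 * (p + p).+1) (2 * p) =
    1 / 3 - cubic_ratio p * ((10 * p%:R + 2) * (3 * p%:R + 1)
                             / ((6 * p%:R + 3) * 2 * (6 * p%:R + 1))) ->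
  center_density (2 * (p.+1 + p).+1) (2 * p.+1) = 1 / 3 - cubic_ratio p.+1 / 12.
Proof.
case: p => [_|p C].
  (* Passing from 2 to 4 points with j = 1 would require d = -1 in [center_density_telescope], so
     this case is computed directly. *)
  have -> : (2 * (1 + 0).+1 = 2 * (0 + 1).+1)%N by [].
  have -> : (2 * 1 = (2 * 0).+2)%N by [].
  rewrite (@center_density_odd 0 1 4); last ring.
  have -> : even_term 0 1 = 1 / 4 by apply/eqP; vm_compute.
  have -> : cubic_ratio 1 = 2 / 5 by apply/eqP; vm_compute.
  by rewrite muln0 /center_density big_ord0; apply/eqP; vm_compute.
have -> : (2 * p.+2 = (2 * p.+1).+2)%N by lia.
have -> : (2 * (p.+2 + p.+1).+1 = 2 * (p.+2 + p).+2)%N by lia.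
have -> : ((2 * p.+1).+2 = 2 * p.+2)%N by lia.
rewrite (@center_density_telescope p.+2 p (4 * p%:R + 6)); last by rewrite -!natr1; ring.
have -> : ((p.+2 + p).+1 = (p.+1 + p.+1).+1)%N by lia.
have -> : (2 * p.+2 = (2 * p.+1).+2)%N by lia.
rewrite density_e C (@even_termSl p.+1 p (4 * p%:R + 6)); last by rewrite -!natr1; ring.
rewrite even_term_diag (cubic_ratioS p.+1); move: (cubic_ratio p.+1) => c.
have x0 := ler0n rat p.
by field; do ?[apply/andP; split] => //; apply: lt0r_neq0; lra.
Qed.

(** The induction alternates with (a): [density_a_rec] turns the hypothesis at p into (a) at p + 1,
    and two more points at the same N give (c) at p + 1. *)
Lemma density_c (n : nat) :
  center_density (2 * (n + n).+1) (2 * n) =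
  1 / 3 - cubic_ratio n * ((10 * n%:R + 2) * (3 * n%:R + 1)
                           / ((6 * n%:R + 3) * 2 * (6 * n%:R + 1))).
Proof.
elim: n => [|p IH].
  rewrite /center_density big_ord0 (_ : cubic_ratio 0 = 1); first by field.
  by apply/eqP; vm_compute.
have -> : ((p.+1 + p.+1).+1 = (p.+1 + p).+2)%N by lia.
rewrite (@center_density_telescope p.+1 p (4 * p%:R + 4)); last by rewrite -!natr1; ring.
rewrite density_a_rec // even_term_subdiag; move: (cubic_ratio p.+1) => c.
have x0 := ler0n rat p.
by field; do ?[apply/andP; split] => //; apply: lt0r_neq0; lra.
Qed.

(** The added term has degree 2p + 4; it lies one [even_termSl] step beyond the diagonal term, hence
    the quotient of the two factors. *)
Lemma density_f (p : nat) :
  center_density (2 * (p.+1 + p.+1).+1) (2 * p.+1).+3 =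
  center_density (2 * (p.+1 + p.+1).+1) (2 * p.+1).+2 + cubic_ratio p.+1 *
   ((3 * p%:R + 4) * (4 * p%:R + 5) / (2 * (2 * p%:R + 3) * (6 * p%:R + 7)) *
    ((2 * p%:R + 3) ^+ 2 * (4 * p%:R + 9) * ((2 * p%:R + 2) * (6 * p%:R + 10))
     / ((4 * p%:R + 5) * ((2 * p%:R + 3) * (6 * p%:R + 9)) * (2 * p%:R + 4) ^+ 2))).
Proof.
have -> : ((p.+1 + p.+1).+1 = (p.+2 + p).+1)%N by lia.
have -> : ((2 * p.+1).+2 = 2 * p.+2)%N by lia.
rewrite center_density_even (@even_termSl p.+1 p (4 * p%:R + 6)); last by rewrite -!natr1; ring.
rewrite even_term_diag; move: (cubic_ratio _) (center_density _ _) => c s.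
have x0 := ler0n rat p.
by field; do ?[apply/andP; split] => //; apply: lt0r_neq0; lra.
Qed.

Lemma density_a (p : nat) :
  center_density (2 * (p.+1 + p).+1) (2 * p.+1) = 1 / 3 - cubic_ratio p.+1 / 12.
Proof. exact/density_a_rec/density_c. Qed.

Theorem corollary7 (n : nat) :
  [/\ (1 <= n)%N ->
      (A (2 * n) (2 * n))%:R =
        (1 / 3 - 1 / 12 * ('C(2 * n, n)%:R ^+ 3 / 'C(6 * n, 3 * n)%:R))
        * T (2 * n) (2 * n),
      (A (2 * n + 1) (2 * n + 1))%:R =
        (1 / 3 + 1 / 3 * ('C(2 * n, n)%:R ^+ 3 / 'C(6 * n + 2, 3 * n + 1)%:R))
        * T (2 * n + 1) (2 * n + 1),
      (A (2 * n) (2 * n + 2))%:R =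
        (1 / 3 - (10 * n + 2)%:R / (6 * n + 3)%:R
                 * ('C(2 * n, n)%:R ^+ 3 / 'C(6 * n + 2, 3 * n + 1)%:R))
        * T (2 * n) (2 * n + 2)
    & [/\ (1 <= n)%N ->
          (A (2 * n + 1) (2 * n - 1))%:R =
            (1 / 3 + (10 * n + 3)%:R / (24 * n)%:R
                     * ('C(2 * n, n)%:R ^+ 3 / 'C(6 * n, 3 * n)%:R))
            * T (2 * n + 1) (2 * n - 1),
          (A (2 * n + 2) (2 * n))%:R =
            (1 / 3 + 4 * ('C(2 * n, n)%:R ^+ 3
                          / 'C(6 * n + 4, 3 * n + 2)%:R))
            * T (2 * n + 2) (2 * n)
        & (1 <= n)%N ->
          (A (2 * n + 3) (2 * n - 1))%:R =
            (1 / 3 + (2 * (6 * n ^ 2 + 9 * n + 2))%:R / ((n + 1) ^ 2)%:R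
                     * ('C(2 * n, n)%:R ^+ 3
                        / 'C(6 * n + 4, 3 * n + 2)%:R))
            * T (2 * n + 3) (2 * n - 1)]].
Proof.
have x0 := ler0n rat n.
split; [| | |split].
- case: n x0 => // p x0 _; rewrite A_eq_T //; last lia.
  have -> : (2 * p.+1 + 2 * p.+1 = 2 * (p.+1 + p).+1)%N by lia.
  by rewrite density_a -/(cubic_ratio _); congr (_ * _); field.
- rewrite A_eq_T; [|lia..].
  have -> : (2 * n + 1 + (2 * n + 1) = 2 * (n + n).+1)%N by lia.
  rewrite cubic_ratio1 [in center_density _ _]addn1 density_b density_c; congr (_ * _).
  move: (cubic_ratio n) => c.
  by field; do ?[apply/andP; split] => //; apply: lt0r_neq0; lra.
(* At n = 0 the hexagon is a segment, outside the scope of [A_eq_T]: no tiling is counted, and the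
   factor 1/3 - (2/3)(1/2) vanishes too. *)
- rewrite cubic_ratio1; have [->|n_gt0] := posnP n.
    rewrite muln0 A0 (_ : cubic_ratio 0 = 1); last by apply/eqP; vm_compute.
    rewrite (_ : 1 / 3 - _ = 0) ?mul0r //; by apply/eqP; vm_compute.
  rewrite A_eq_T; [|lia..].
  have -> : (2 * n + (2 * n + 2) = 2 * (n + n).+1)%N by lia.
  rewrite density_c; congr (_ * _); move: (cubic_ratio n) => c.
  by field; do ?[apply/andP; split] => //; apply: lt0r_neq0; lra.
- case: n x0 => // p x0 _; rewrite A_eq_T; [|lia..].
  have -> : (2 * p.+1 + 1 + (2 * p.+1 - 1) = 2 * (p.+1 + p).+1)%N by lia.
  rewrite [in center_density _ _]addn1 center_density_even density_a even_term_subdiag.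
  rewrite -/(cubic_ratio _); congr (_ * _); move: (cubic_ratio p.+1) => c.
  have y0 := ler0n rat p.
  by field; do ?[apply/andP; split] => //; apply: lt0r_neq0; lra.
- rewrite A_eq_T; [|lia..].
  have -> : (2 * n + 2 + 2 * n = 2 * (n + n).+1)%N by lia.
  rewrite cubic_ratio2 [in center_density _ _]addn2 density_e density_c; congr (_ * _).
  move: (cubic_ratio n) => c.
  by field; do ?[apply/andP; split] => //; apply: lt0r_neq0; lra.
case: n x0 => // p x0 _; rewrite A_eq_T; [|lia..].
have -> : (2 * p.+1 + 3 + (2 * p.+1 - 1) = 2 * (p.+1 + p.+1).+1)%N by lia.
rewrite cubic_ratio2 [in center_density _ _]addn3 density_f density_e density_c.
congr (_ * _); move: (cubic_ratio p.+1) => c; have y0 := ler0n rat p.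
rewrite !expnS expn0 !muln1.
by field; do ?[apply/andP; split] => //; apply: lt0r_neq0; lra.
Qed.
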